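(* Let $\mathbf{x}_1,\dots,\mathbf{x}_N\in\mathbb{R}^K$, let $\mathbf{T}$ be a real symmetric positive definite $K\times K$ matrix, and let $\alpha_0\ge0$. Suppose that (i) $\mathbf{x}_i\neq\mathbf{0}$ for every $i$; (ii) for every proper subspace $S\subseteq\mathbb{R}^K$, $P_N(S)<\frac{(1+\alpha_0)\dim(S)}{K}$. Then the equation $$\boldsymbol{\Sigma}=\frac{1}{1+\alpha_0}\frac KN\sum_{i=1}^N\frac{\mathbf{x}_i\mathbf{x}_i^T}{\mathbf{x}_i^T\boldsymbol{\Sigma}^{-1}\mathbf{x}_i}+\frac{\alpha_0}{1+\alpha_0}\frac{K\mathbf{T}}{\mathrm{Tr}(\boldsymbol{\Sigma}^{-1}\mathbf{T})}$$ has a solution $\boldsymbol{\Sigma}\in\mathbb{S}_{++}^K$, which is unique up to a positive scaling factor, and the solutions are the global minima over $\mathbb{S}_{++}^K$ of the loss function $$L^{\mathrm{Wiesel}}(\boldsymbol{\Sigma})=\log\det(\boldsymbol{\Sigma})+\frac KN\sum_{i=1}^N\log\left(\mathbf{x}_i^T\boldsymbol{\Sigma}^{-1}\mathbf{x}_i\right)+\alpha_0\left(K\log\left(\mathrm{Tr}(\boldsymbol{\Sigma}^{-1}\mathbf{T})\right)+\log\det(\boldsymbol{\Sigma})\right).$$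
   Context: $\mathbb{S}_{++}^K$ is the set of real symmetric positive definite $K\times K$ matrices. $P_N(S)=\frac1N\sum_{i=1}^N 1_{\{\mathbf{x}_i\in S\}}$ is the proportion of samples lying in $S$. ''Proper subspace'' means a linear subspace $S$ with $1\le\dim S\le K-1$. *)

(* Defs.v *)
From mathcomp Require Import all_boot all_order all_algebra.
From mathcomp Require Import reals exp.

Set Implicit Arguments.
Unset Strict Implicit.
Unset Printing Implicit Defensive.

Import Order.TTheory GRing.Theory Num.Theory.
Local Open Scope ring_scope.

Section RegularizedTyler.
Variables (R : realType) (K N : nat).
Implicit Types (A T Sigma : 'M[R]_K) (v : 'cV[R]_K) (x : 'I_N -> 'cV[R]_K).

(* [_ *m _] is a 1 x 1 matrix, whence the projection [0 0]. *)
Definition quadform A v : R := (v^T *m A *m v) 0 0.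

Definition posdefmx A : Prop :=
  A^T = A /\ forall v, v != 0 -> 0 < quadform A v.

Definition proportion x (S : {vspace 'cV[R]_K}) : R :=
  N%:R^-1 * \sum_(i < N) (x i \in S)%:R.

Definition proper_subspace (S : {vspace 'cV[R]_K}) : Prop :=
  (1 <= \dim S <= K.-1)%N.

Definition tyler_map (alpha0 : R) x T Sigma : 'M[R]_K :=
  (1 / (1 + alpha0) * (K%:R / N%:R)) *:
    (\sum_(i < N) (quadform (invmx Sigma) (x i))^-1 *: (x i *m (x i)^T))
  + (alpha0 / (1 + alpha0)) *:
    ((K%:R / \tr (invmx Sigma *m T)) *: T).

Definition wiesel_solution (alpha0 : R) x T Sigma : Prop :=
  posdefmx Sigma /\ Sigma = tyler_map alpha0 x T Sigma.

Definition wiesel_loss (alpha0 : R) x T Sigma : R :=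
  ln (\det Sigma)
  + K%:R / N%:R * (\sum_(i < N) ln (quadform (invmx Sigma) (x i)))
  + alpha0 * (K%:R * ln (\tr (invmx Sigma *m T)) + ln (\det Sigma)).

Definition posdef_global_min (L : 'M[R]_K -> R) Sigma : Prop :=
  posdefmx Sigma /\ forall Sigma', posdefmx Sigma' -> L Sigma <= L Sigma'.

End RegularizedTyler.

(* Main.v *)
(* Solutions are minima: diagonalize Sigma^-1 and Sigma'^-1 simultaneously, as
   the identity and diag(d).  The diagonal entries of the equation then turn
   L(Sigma') - L(Sigma) into a nonnegative combination of the gaps in Jensen's
   inequality for ln, with the entries of d as data.  If all gaps vanish, then d
   is constant: because T is definite if alpha0 > 0, and by (ii) applied to an
   eigenspace if alpha0 = 0.  Hence minimizers are multiples of any solution.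

   Existence: the equation is the critical point equation, at Sigma = M(w), of
     (1 + alpha0) ln det M(w) - K/N sum_i ln w_i,
     M(w) = alpha0 T + sum_i w_i x_i x_i^T,
   over positive weights w.  Adding the terms of M(w) by decreasing weight, the
   determinant gains a factor of order w_i each time x_i is not in the span of
   the previous vectors.  By Abel summation and (ii), the functional is coercive
   (up to scaling of w if alpha0 = 0), so that a minimizer exists. *)
Require Import Defs.
From mathcomp Require Import all_boot all_order all_algebra.
From mathcomp Require Import ring lra.
From mathcomp Require Import boolp classical_sets reals topology normedtype.
From mathcomp Require Import sequences derive exp.

Set Implicit Arguments.
Unset Strict Implicit.
Unset Printing Implicit Defensive.

Import Order.TTheory GRing.Theory Num.Theory.
Import numFieldNormedType.Exports.
Local Open Scope ring_scope.

(** * Quadratic forms and positive definite matrices *)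

Section QuadraticForms.
Context {R : realType}.

Lemma quadformDl n (A B : 'M[R]_n) v :
  quadform (A + B) v = quadform A v + quadform B v.
Proof. by rewrite /quadform mulmxDr mulmxDl mxE. Qed.

Lemma quadformZl n a (A : 'M[R]_n) v : quadform (a *: A) v = a * quadform A v.
Proof. by rewrite /quadform -scalemxAr -scalemxAl mxE. Qed.

Lemma quadformZr n a (A : 'M[R]_n) v :
  quadform A (a *: v) = a ^+ 2 * quadform A v.
Proof.
by rewrite /quadform [(a *: v)^T]linearZ /= -!scalemxAl -scalemxAr !mxE mulrA expr2.
Qed.

Lemma quadform_sum n I (r : seq I) (P : pred I) (F : I -> 'M[R]_n) v :
  quadform (\sum_(i <- r | P i) F i) v = \sum_(i <- r | P i) quadform (F i) v.
Proof.
rewrite (big_morph (fun A : 'M[R]_n => quadform A v) (id1 := 0) (op1 := +%R)) //.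
  by move=> A B; rewrite quadformDl.
by rewrite /quadform mulmx0 mul0mx mxE.
Qed.

Lemma quadform0 n (A : 'M[R]_n) : quadform A 0 = 0.
Proof. by rewrite /quadform mulmx0 mxE. Qed.

Lemma quadform_congr m n (G : 'M[R]_(m, n)) (A : 'M[R]_m) v :
  quadform (G^T *m A *m G) v = quadform A (G *m v).
Proof. by rewrite /quadform trmx_mul !mulmxA. Qed.

Lemma trmx11E (B : 'M[R]_1) : B^T 0 0 = B 0 0.
Proof. by rewrite mxE. Qed.

Lemma quadform_outer n (x v : 'cV[R]_n) :
  quadform (x *m x^T) v = ((x^T *m v) 0 0) ^+ 2.
Proof.
rewrite /quadform mulmxA -mulmxA mxE big_ord1 expr2; congr (_ * _).
by rewrite -[LHS]trmx11E trmx_mul trmxK.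
Qed.

Lemma quadform_tr n (A : 'M[R]_n) v : quadform A v = \tr (A *m (v *m v^T)).
Proof.
by rewrite mulmxA mxtrace_mulC mulmxA /mxtrace big_ord1 /quadform.
Qed.

Lemma bilinear_sym n (A : 'M[R]_n) (u v : 'cV[R]_n) :
  A^T = A -> (u^T *m A *m v) 0 0 = (v^T *m A *m u) 0 0.
Proof.
by move=> hA; rewrite -[LHS]trmx11E !trmx_mul trmxK hA mulmxA.
Qed.

Lemma quadformDr n (A : 'M[R]_n) u v : A^T = A ->
  quadform A (u + v)
  = quadform A u + 2 * (u^T *m A *m v) 0 0 + quadform A v.
Proof.
move=> hA; rewrite /quadform [(u + v)^T]linearD /= !mulmxDl !mulmxDr.
have mxD (B C : 'M[R]_1) : (B + C) 0 0 = B 0 0 + C 0 0 by rewrite mxE.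
rewrite !mxD (bilinear_sym v u hA); ring.
Qed.

Lemma quadform1 n (v : 'cV[R]_n) : quadform 1%:M v = \sum_i v i 0 ^+ 2.
Proof.
rewrite /quadform mulmx1 mxE; apply: eq_bigr => i _.
by rewrite !mxE expr2.
Qed.

Lemma quadform_diag n (d : 'rV[R]_n) (v : 'cV[R]_n) :
  quadform (diag_mx d) v = \sum_i d 0 i * v i 0 ^+ 2.
Proof.
rewrite /quadform mul_mx_diag mxE; apply: eq_bigr => i _.
by rewrite !mxE; ring.
Qed.

Lemma quadform_delta n (A : 'M[R]_n) j : quadform A (delta_mx j 0) = A j j.
Proof. by rewrite /quadform trmx_delta -rowE -colE !mxE. Qed.

Lemma quadform1_gt0 n (v : 'cV[R]_n) : v != 0 -> 0 < quadform 1%:M v.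
Proof.
move=> v0; rewrite quadform1 lt_def sumr_ge0 ?andbT; last by move=> i _; apply: sqr_ge0.
apply: contra v0 => /eqP /psumr_eq0P h; apply/eqP/colP => i.
by rewrite mxE; apply/eqP; rewrite -sqrf_eq0 h // => j _; apply: sqr_ge0.
Qed.

(** If [w = C v] were nonzero, moving [v] slightly against [w] would make the form negative: the
    linear term [2 t |w|^2] dominates for small negative [t]. *)
Lemma psd_kernel n (C : 'M[R]_n) (v : 'cV[R]_n) :
  C^T = C -> (forall u, 0 <= quadform C u) -> quadform C v = 0 -> C *m v = 0.
Proof.
move=> hC Cpsd Cv; apply/eqP; apply: contraT => w0.
set w := C *m v in w0 *.
have a0 : 0 < quadform 1%:M w by exact: quadform1_gt0.
have b0 := Cpsd w.
set a := quadform _ w in a0; set b := quadform C w in b0.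
(* The best step would be [- a / b]; [b + 1] also covers [b = 0] and still gives a negative
   value. *)
have := Cpsd (v + (- a / (b + 1)) *: w).
rewrite quadformDr // Cv quadformZr -/b -scalemxAr [X in 2 * X]mxE.
have -> : (v^T *m C *m w) 0 0 = a.
  by rewrite bilinear_sym // /a /quadform mulmx1 -mulmxA.
rewrite add0r leNgt => /negP[].
have b1 : 0 < b + 1 by rewrite ltr_wpDl.
have bn0 : b + 1 != 0 by rewrite gt_eqF.
have -> : 2 * (- a / (b + 1) * a) + (- a / (b + 1)) ^+ 2 * b
  = - (a ^+ 2 * (b + 2)) / (b + 1) ^+ 2 by field.
rewrite mulNr oppr_lt0 divr_gt0 ?exprn_gt0 //.
by rewrite mulr_gt0 ?exprn_gt0 // ltr_wpDl.
Qed.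

Lemma posdef_quadform_ge0 n (A : 'M[R]_n) v : posdefmx A -> 0 <= quadform A v.
Proof.
move=> hA; have [->|v0] := eqVneq v 0; first by rewrite quadform0.
by apply: ltW; apply: hA.2.
Qed.

Lemma posdef_congr n (G A : 'M[R]_n) : G \in unitmx -> posdefmx A ->
  posdefmx (G^T *m A *m G).
Proof.
move=> hG [hA Apos]; split=> [|v v0]; first by rewrite !trmx_mul trmxK hA mulmxA.
rewrite quadform_congr; apply: Apos; apply: contra v0 => /eqP h.
by rewrite -[v](mulKmx hG) h mulmx0.
Qed.

Lemma posdef_unitmx n (A : 'M[R]_n) : posdefmx A -> A \in unitmx.
Proof.
move=> [hA Apos]; rewrite -row_free_unit -kermx_eq0; apply: contraT => /rowV0Pn[u].
move=> /sub_kermxP uA u0.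
have : 0 < quadform A u^T by apply: Apos; rewrite -trmx0 (inj_eq trmx_inj).
by rewrite /quadform trmxK uA mul0mx mxE ltxx.
Qed.

(** Completion of [v] to a basis: [v^T] has rank one, so it is a scalar multiple of the first row of
    its own [row_ebase]. *)
Lemma unitmx_col0 n (v : 'cV[R]_n.+1) : v != 0 ->
  exists2 G : 'M[R]_n.+1, G \in unitmx & col 0 G = v.
Proof.
move=> v0.
have rv : \rank v^T = 1%N.
  by apply/eqP; rewrite eqn_leq rank_leq_row lt0n mxrank_eq0 -trmx0 (inj_eq trmx_inj).
have := mulmx_ebase v^T; rewrite rv.
have := row_ebase_unit v^T; have := col_ebase_unit v^T.
set c := col_ebase _; set r := row_ebase _ => hc hr e.
have c0 : c 0 0 \is a GRing.unit by move: hc; rewrite unitmxE det_mx11.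
exists (c 0 0 *: r)^T; first by rewrite unitmx_tr unitmxZ.
rewrite -tr_row; apply: trmx_inj; rewrite trmxK -e.
apply/rowP => j; rewrite !mxE big_ord_recl big1 => [|i _].
  by rewrite addr0; congr (_ * _); rewrite mxE big_ord1 !mxE mulr1.
by rewrite mxE big_ord1 mxE /= mulr0 mul0r.
Qed.

End QuadraticForms.

(** * Continuity of sums, products and determinants *)

Section Continuity.
Context {R : realType} {T : topologicalType}.

Lemma continuous_for_sum I (r : seq I) (P : pred I) (F : I -> T -> R) (x : T) :
  (forall i, P i -> {for x, continuous (F i)}) ->
  {for x, continuous (fun y => \sum_(i <- r | P i) F i y)}.
Proof. by move=> h; apply: cvg_big => //; exact: add_continuous. Qed.

Lemma continuous_for_prod I (r : seq I) (P : pred I) (F : I -> T -> R) (x : T) :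
  (forall i, P i -> {for x, continuous (F i)}) ->
  {for x, continuous (fun y => \prod_(i <- r | P i) F i y)}.
Proof. by move=> h; apply: cvg_big => //; exact: mul_continuous. Qed.

Lemma continuous_det n (M : T -> 'M[R]_n) (x : T) :
  (forall i j, {for x, continuous (fun y => M y i j)}) ->
  {for x, continuous (fun y => \det (M y))}.
Proof.
move=> h; rewrite /determinant; apply: continuous_for_sum => s _.
by apply: continuousM; [exact: cst_continuous|exact: continuous_for_prod].
Qed.

End Continuity.

(** * Simultaneous diagonalization *)

Section SimultaneousDiagonalization.
Local Open Scope classical_set_scope.
Local Open Scope ring_scope.
Context {R : realType}.

Lemma continuous_quadform_tr n (A : 'M[R]_n) :
  continuous (fun w : 'rV[R]_n => quadform A w^T).
Proof.
move=> w; rewrite (_ : (fun _ => _) = fun w : 'rV[R]_n =>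
    \sum_j (\sum_i w 0 i * A i j) * w 0 j); last first.
  apply/funext => y; rewrite /quadform mxE; apply: eq_bigr => j _.
  rewrite !mxE; congr (_ * _); apply: eq_bigr => i _.
  by rewrite !mxE.
apply: continuous_for_sum => j _; apply: continuousM; last exact: coord_continuous.
apply: continuous_for_sum => i _; apply: continuousM; first exact: coord_continuous.
exact: cst_continuous.
Qed.

(* The Rayleigh quotient B/A attains its minimum mu on the unit sphere, and
   B - mu A is then positive semidefinite with the minimizer in its kernel. *)
Lemma pencil_eigenvector n (A B : 'M[R]_n.+1) : posdefmx A -> B^T = B ->
  exists mu, exists2 v : 'cV[R]_n.+1, v != 0 & B *m v = mu *: (A *m v).
Proof.
move=> hA hB; pose f (w : 'rV[R]_n.+1) := quadform B w^T / quadform A w^T.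
(* The norm is the maximum norm. Since [f] is invariant under scaling, its minimum on this sphere is
   its minimum over all nonzero vectors. *)
pose S := [set w : 'rV[R]_n.+1 | `|w| = 1]%classic.
have Sn0 w : S w -> w^T != 0.
  rewrite /S /= => w1; apply: contra_eq_neq w1 => /(congr1 trmx).
  by rewrite trmxK trmx0 => ->; rewrite normr0 eq_sym oner_eq0.
have Scomp : compact S.
  apply: bounded_closed_compact.
    by exists 1; split=> // M ltM w /= ->; exact: ltW.
  move/continuous_closedP: (@norm_continuous _ 'rV[R]_n.+1) => /(_ [set r | r = 1]%classic).
  by apply; exact: closed_eq.
have Snorm (w : 'rV[R]_n.+1) : w != 0 -> S (`|w|^-1 *: w).
  move=> w0; rewrite /S /= normrZ normfV normr_id mulVf //.
  by rewrite normr_eq0.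
have Sne : (S !=set0)%classic.
  exists (`|const_mx 1 : 'rV[R]_n.+1|^-1 *: const_mx 1); apply: Snorm.
  by apply/eqP => /rowP/(_ 0)/eqP; rewrite !mxE oner_eq0.
have fcont : {within S, continuous f}.
  apply: continuous_in_subspaceT => w /set_mem Sw; rewrite /f.
  apply: (@continuousM _ _ (fun w => quadform B w^T) (fun w => (quadform A w^T)^-1));
    first exact: continuous_quadform_tr.
  apply: continuousV; last exact: continuous_quadform_tr.
  by rewrite gt_eqF // hA.2 // Sn0.
have [w /set_mem Sw wmin] := EVT_min_rV Sne Scomp fcont.
exists (f w), w^T; first exact: Sn0.
have hC : (B - f w *: A)^T = B - f w *: A.
  by rewrite linearB linearZ /= hB hA.1.
have qC v : quadform (B - f w *: A) v = quadform B v - f w * quadform A v.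
  by rewrite quadformDl -scaleNr quadformZl mulNr.
apply/eqP; rewrite -subr_eq0 scalemxAl -mulmxBl; apply/eqP.
apply: psd_kernel => // [u|]; rewrite qC; last first.
  by rewrite /f divfK ?subrr // gt_eqF // hA.2 // Sn0.
have [->|u0] := eqVneq u 0; first by rewrite !quadform0 mulr0 subr0.
have ut0 : u^T != 0 by rewrite -trmx0 (inj_eq trmx_inj).
have n0 : `|u^T|^-1 ^+ 2 != 0 by rewrite sqrf_eq0 invr_eq0 normr_eq0.
have := wmin _ (mem_set (Snorm _ ut0)).
rewrite {2}/f linearZ /= trmxK !quadformZr -mulf_div divff // mul1r.
by rewrite ler_pdivlMr ?hA.2 // subr_ge0.
Qed.

(** Induction on the dimension. In a basis that starts with a generalized eigenvector [v] and
    continues in its [A]-orthogonal complement, both matrices are block diagonal: the first column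
    of [B] is [mu] times that of [A], and symmetry clears the first row. *)
Lemma simultaneous_diagonalization n (A B : 'M[R]_n) :
  posdefmx A -> B^T = B ->
  exists F (d : 'rV[R]_n),
    [/\ F \in unitmx, F^T *m A *m F = 1%:M & F^T *m B *m F = diag_mx d].
Proof.
elim: n A B => [|n IH]; last rewrite -[n.+1]/(1 + n)%N; move=> A B hA hB.
  exists 1%:M, 0; split; first exact: unitmx1.
    by apply/matrixP => -[].
  by apply/matrixP => -[].
have [mu [v v0 Bv]] : exists mu, exists2 v : 'cV[R]_(1 + n),
    v != 0 & B *m v = mu *: (A *m v) := pencil_eigenvector hA hB.
have [G0 uG0 G0v] : exists2 G : 'M[R]_(1 + n), G \in unitmx & col 0 G = v :=
  unitmx_col0 v0.
have := posdef_congr uG0 hA.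
pose A0 : 'M_(1 + n) := G0^T *m A *m G0.
rewrite -[X in posdefmx X]/A0; have eA0 : A0 = G0^T *m A *m G0 by [].
clearbody A0 => hA0.
set a := A0 0 0; have a0 : 0 < a.
  rewrite /a -quadform_delta hA0.2 //; apply/eqP => /colP/(_ 0)/eqP.
  by rewrite !mxE eqxx oner_eq0.
have ulA0 : ulsubmx A0 = a%:M.
  apply/matrixP => i j; rewrite !ord1 !mxE eqxx mulr1n.
  by rewrite /a; congr (A0 _ _); apply: val_inj.
have dlA0 : dlsubmx A0 = (ursubmx A0)^T by rewrite trmx_ursub hA0.1.
(* One step of symmetric Gaussian elimination on [A0]. It fixes the first basis vector, so the first
   column of [G] is still [v]. *)
pose U : 'M_(1 + n) := block_mx 1%:M (- a^-1 *: ursubmx A0) 0 1%:M.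
have uU : U \in unitmx by rewrite unitmxE det_ublock !det1 mulr1 unitr1.
pose G : 'M[R]_(1 + n) := G0 *m U.
have uG : G \in unitmx by rewrite unitmx_mul uG0.
have eG : G = G0 *m U by [].
clearbody G.
have hA1 := posdef_congr uG hA; set A1 : 'M[R]_(1 + n) := _ *m G in hA1.
have e0 : delta_mx 0 0 = col_mx 1%:M 0 :> 'cV[R]_(1 + n).
  apply/colP => i; case: (split_ordP i) => j ->; rewrite ?col_mxEu ?col_mxEd.
    by rewrite !mxE !ord1.
  by rewrite !mxE.
have ae0 b : b *: delta_mx 0 0 = col_mx b%:M 0 :> 'cV[R]_(1 + n).
  apply/colP => i; case: (split_ordP i) => j ->; rewrite ?col_mxEu ?col_mxEd.
    by rewrite !mxE !ord1 mulr1.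
  by rewrite !mxE mulr0.
have Ue0 : U *m (col_mx 1%:M 0 : 'cV_(1 + n)) = col_mx 1%:M 0.
  by rewrite /U mul_block_col !mul1mx mulmx0 mul0mx !addr0.
have Gv : G *m delta_mx 0 0 = v.
  rewrite eG -mulmxA -[RHS]G0v colE; congr (_ *m _).
  by rewrite e0 Ue0.
pose B1 : 'M[R]_(1 + n) := G^T *m B *m G.
have hB1 : B1^T = B1 by rewrite /B1 !trmx_mul trmxK hB mulmxA.
have B1A1 : B1 *m delta_mx 0 0 = mu *: (A1 *m delta_mx 0 0) :> 'cV[R]_(1 + n).
  by rewrite /B1 /A1 -!mulmxA Gv Bv -scalemxAr.
have eA1 : A1 = block_mx a%:M 0 0 (drsubmx A1).
  have -> : A1 = U^T *m A0 *m U by rewrite /A1 eA0 eG trmx_mul !mulmxA.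
  rewrite -[A0](submxK A0) ulA0 dlA0 /U tr_block_mx.
  rewrite !mulmx_block block_mxKdr !trmx1 !trmx0 !mul0mx !mul1mx !mulmx1 !mulmx0.
  rewrite ![(_ *: _)^T]linearZ /= !addr0 mul_scalar_mx mul_mx_scalar !scalerA.
  have -> : a * - a^-1 = -1 by field; rewrite gt_eqF.
  by rewrite !scaleN1r !addNr.
have colA1 : A1 *m delta_mx 0 0 = a *: delta_mx 0 0 :> 'cV[R]_(1 + n).
  rewrite eA1 e0 mul_block_col mulmx1 !mulmx0 mul0mx !addr0.
  by rewrite -e0 ae0.
have eB1 : B1 = block_mx (mu * a)%:M 0 0 (drsubmx B1).
  have : B1 *m delta_mx 0 0 = col_mx (mu * a)%:M 0 :> 'cV[R]_(1 + n).
    by rewrite B1A1 colA1 scalerA ae0.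
  rewrite -[B1 in LHS](submxK B1) e0 mul_block_col !mulmx1 !mulmx0.
  rewrite !addr0 => /eq_col_mx[ulB dlB].
  rewrite -[LHS](submxK B1) ulB dlB; congr block_mx.
  by apply: trmx_inj; rewrite trmx_ursub hB1 dlB trmx0.
have hA' : posdefmx (drsubmx A1).
  split=> [|w w0]; first by rewrite trmx_drsub hA1.1.
  have := hA1.2 (col_mx 0 w); rewrite col_mx_eq0 (negPf w0) andbF => /(_ isT).
  rewrite {1}eA1 /quadform tr_col_mx mul_row_block mul_row_col.
  by rewrite !mulmx0 !add0r.
have hB' : (drsubmx B1)^T = drsubmx B1.
  by rewrite trmx_drsub hB1.
have [F' [d' [uF' FA FB]]] := IH _ _ hA' hB'.
pose s := Num.sqrt a; have s2 : s ^+ 2 = a by rewrite sqr_sqrtr // ltW.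
have s0 : s != 0 by rewrite gt_eqF // sqrtr_gt0.
(* The factor [s^-1] normalizes [v] for the form [A], as [a] is the value of that form at [v]. *)
pose V : 'M[R]_(1 + n) := block_mx s^-1%:M 0 0 F'.
exists (G *m V), (row_mx mu%:M d' : 'rV_(1 + n)); split.
- by rewrite unitmx_mul uG /= unitmxE det_ublock det_scalar1 unitrM unitrV unitfE s0.
- have -> : (G *m V)^T *m A *m (G *m V) = V^T *m A1 *m V.
    by rewrite /A1 trmx_mul !mulmxA.
  rewrite eA1 /V tr_block_mx !mulmx_block !trmx0 !mulmx0 !mul0mx !addr0 !add0r FA.
  rewrite tr_scalar_mx -!scalar_mxM -s2.
  have -> : s^-1 * s ^+ 2 / s = 1 by field.
  by rewrite ?mul0mx ?mulmx0 [RHS]scalar_mx_block.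
- have -> : (G *m V)^T *m B *m (G *m V) = V^T *m B1 *m V.
    by rewrite /B1 trmx_mul !mulmxA.
  rewrite eB1 /V tr_block_mx !mulmx_block !trmx0 !mulmx0 !mul0mx !addr0 !add0r FB.
  rewrite tr_scalar_mx -!scalar_mxM -s2.
  have -> : s^-1 * (mu * s ^+ 2) / s = mu by field.
  have e1 : diag_mx mu%:M = mu%:M :> 'M[R]_1 by apply/matrixP => i j; rewrite !mxE !ord1.
  by rewrite ?mul0mx ?mulmx0 diag_mx_row e1.
Qed.
End SimultaneousDiagonalization.

(** * Solutions minimize the loss *)

Section Jensen.
Context {R : realType}.

Lemma ln_le_sub1 (x : R) : 0 < x -> ln x <= x - 1.
Proof. by move=> x0; rewrite -{1}(subrK 1 x) addrC le_ln1Dx // ltrBrDr addNr. Qed.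

Lemma ln_eq_sub1 (x : R) : 0 < x -> ln x = x - 1 -> x = 1.
Proof.
move=> x0 e; apply/eqP; apply: contraT => x1.
have : ln x != 0 by rewrite ln_eq0.
by move/expR_gt1Dx; rewrite lnK ?posrE // e addrC subrK ltxx.
Qed.

(** The gap for the weights [a j / \sum_j a j], multiplied by [\sum_j a j]. *)
Definition jensen_gap n (a d : 'I_n -> R) : R :=
  (\sum_j a j) * (ln (\sum_j a j * d j) - ln (\sum_j a j)) - \sum_j a j * ln (d j).

(** Let [r j] be [d j] divided by the weighted mean. The weighted sum of [r j - 1] is zero, so the
    gap is the weighted sum of [r j - 1 - ln (r j)], whose terms are nonnegative and vanish only for
    [r j = 1] or weight zero. *)
Lemma jensen_ln n (a d : 'I_n -> R) :
  (forall j, 0 <= a j) -> 0 < \sum_j a j -> (forall j, 0 < d j) ->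
  0 <= jensen_gap a d /\
  (jensen_gap a d = 0 ->
   forall j, a j != 0 -> d j = (\sum_j a j * d j) / \sum_j a j).
Proof.
move=> a0 s0 d0; rewrite /jensen_gap; set s := \sum_j a j in s0 *; set t := \sum_j _ * d _.
have t0 : 0 < t.
  have t_ge : 0 <= t by apply: sumr_ge0 => j _; rewrite mulr_ge0 // ltW.
  rewrite lt_def t_ge andbT; apply: contraL s0 => /eqP /psumr_eq0P h.
  rewrite /s big1 ?ltxx // => j _.
  have /eqP := h (fun j _ => mulr_ge0 (a0 j) (ltW (d0 j))) j isT.
  by rewrite mulf_eq0 (gt_eqF (d0 j)) orbF => /eqP.
pose r j := d j * s / t.
have r0 j : 0 < r j by rewrite divr_gt0 // mulr_gt0.
have gapE : s * (ln t - ln s) - \sum_j a j * ln (d j)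
    = \sum_j a j * (r j - 1 - ln (r j)).
  have lnr j : ln (r j) = ln (d j) + ln s - ln t.
    by rewrite /r ln_div ?posrE ?mulr_gt0 // lnM ?posrE.
  under [RHS]eq_bigr => j _.
    rewrite lnr (_ : _ * _ = a j * d j * (s / t) + a j * (ln t - ln s - 1) - a j * ln (d j));
      last by rewrite /r; ring.
    over.
  rewrite sumrB big_split /= -!mulr_suml -/s -/t.
  have -> : t * (s / t) = s by field; rewrite gt_eqF.
  ring.
have term0 j : 0 <= a j * (r j - 1 - ln (r j)).
  by rewrite mulr_ge0 // subr_ge0 ln_le_sub1.
rewrite gapE; split; first by apply: sumr_ge0.
move=> /psumr_eq0P h j aj0.
have /eqP := h (fun j _ => term0 j) j isT.
rewrite mulf_eq0 (negPf aj0) /= subr_eq0 => /eqP /esym /(ln_eq_sub1 (r0 j)) rj.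
have tn : t != 0 by rewrite gt_eqF.
have sn : s != 0 by rewrite gt_eqF.
by apply: (mulIf sn); rewrite divfK // -[RHS]mul1r -rj /r divfK.
Qed.

End Jensen.

(** * Determinant, inverse and diagonal of positive definite matrices *)

Section Posdef.
Context {R : realType}.

Lemma posdef_det_gt0 n (A : 'M[R]_n) : posdefmx A -> 0 < \det A.
Proof.
move=> hA; have [F [d [uF FA _]]] := simultaneous_diagonalization hA (trmx1 _ _).
have : \det (F^T *m A *m F) = 1 by rewrite FA det1.
rewrite !det_mulmx det_tr mulrAC -expr2 => h.
have F0 : 0 < \det F ^+ 2.
  by rewrite lt_def sqr_ge0 andbT sqrf_eq0 -unitfE -unitmxE.
by rewrite -(pmulr_rgt0 _ F0) h ltr01.
Qed.

Lemma posdef_inv n (A : 'M[R]_n) : posdefmx A -> posdefmx (invmx A).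
Proof.
move=> hA; have uA := posdef_unitmx hA.
have -> : invmx A = (invmx A)^T *m A *m invmx A.
  by rewrite -mulmxA mulmxV // mulmx1 trmx_inv hA.1.
by apply: posdef_congr => //; rewrite unitmx_inv.
Qed.

Lemma posdef_diag_gt0 n (A : 'M[R]_n) j : posdefmx A -> 0 < A j j.
Proof.
move=> hA; rewrite -quadform_delta hA.2 //.
by apply/eqP => /colP/(_ j)/eqP; rewrite !mxE !eqxx oner_eq0.
Qed.

Lemma posdef_scale n c (A : 'M[R]_n) : 0 < c -> posdefmx A -> posdefmx (c *: A).
Proof.
move=> c0 hA; split=> [|v v0]; first by rewrite linearZ /= hA.1.
by rewrite quadformZl mulr_gt0 // hA.2.
Qed.

End Posdef.

(** * Comparison of the loss of a solution with the loss elsewhere *)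

Section Minimality.
Context {R : realType} {K N : nat}.
Context (hK : (0 < K)%N) (hN : (0 < N)%N).
Implicit Types (T Sigma : 'M[R]_K) (x : 'I_N -> 'cV[R]_K).

Lemma sum_pos_gt0 (a : 'I_K -> R) : (forall j, 0 < a j) -> 0 < \sum_j a j.
Proof.
move=> a0; rewrite (bigD1 (Ordinal hK)) //= ltr_pwDl ?a0 //.
by apply: sumr_ge0 => j _; apply: ltW.
Qed.

(** The intended data, in a basis diagonalizing both inverses: [a i j] are the squared coordinates
    of the samples, [tau] is the diagonal of [T], [d] holds the eigenvalues, and [gap] is the
    difference of the losses. The diagonal equations distribute [(1 + alpha) * \sum_j ln (d j)] over
    the Jensen gaps of the [a i] and of [tau]. *)
Lemma diagonal_gap (alpha : R) (a : 'I_N -> 'I_K -> R) (tau d : 'I_K -> R) :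
  0 <= alpha -> (forall i j, 0 <= a i j) -> (forall i, 0 < \sum_j a i j) ->
  (forall j, 0 < tau j) -> (forall j, 0 < d j) ->
  (forall j, 1 = 1 / (1 + alpha) * (K%:R / N%:R) * (\sum_i (\sum_k a i k)^-1 * a i j)
                 + alpha / (1 + alpha) * (K%:R / (\sum_k tau k) * tau j)) ->
  let gap := K%:R / N%:R *
      (\sum_i (ln (\sum_j a i j * d j) - ln (\sum_j a i j)))
    + alpha * (K%:R * (ln (\sum_j tau j * d j) - ln (\sum_j tau j)))
    - (1 + alpha) * \sum_j ln (d j) in
  0 <= gap /\
  (gap = 0 ->
     (forall i j, a i j != 0 -> d j = (\sum_j a i j * d j) / \sum_j a i j) /\
     (0 < alpha -> forall j, d j = (\sum_j tau j * d j) / \sum_j tau j)).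
Proof.
move=> al0 a0 s0 tau0 d0 hdiag.
have al1 : 0 < 1 + alpha by rewrite ltr_pwDl.
have t0 := sum_pos_gt0 tau0.
have K0 : 0 < K%:R :> R by rewrite ltr0n.
have N0 : 0 < N%:R :> R by rewrite ltr0n.
have ga i := jensen_ln (a0 i) (s0 i) d0.
have gt := jensen_ln (fun j => ltW (tau0 j)) t0 d0.
have sn i : \sum_k a i k != 0 by rewrite gt_eqF.
have tn : \sum_k tau k != 0 by rewrite gt_eqF.
move=> gap.
have gapE : gap = \sum_i (K%:R / N%:R * ((\sum_k a i k)^-1 * jensen_gap (a i) d))
                  + alpha * (K%:R / (\sum_k tau k) * jensen_gap tau d).
  have -> : \sum_i (K%:R / N%:R * ((\sum_k a i k)^-1 * jensen_gap (a i) d))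
     = K%:R / N%:R * (\sum_i (ln (\sum_j a i j * d j) - ln (\sum_j a i j)))
       - \sum_j (K%:R / N%:R * (\sum_i (\sum_k a i k)^-1 * a i j)) * ln (d j).
    rewrite mulr_sumr.
    have -> : \sum_j (K%:R / N%:R * (\sum_i (\sum_k a i k)^-1 * a i j)) * ln (d j)
       = \sum_i K%:R / N%:R * ((\sum_k a i k)^-1 * \sum_j (a i j * ln (d j))).
      rewrite -mulr_sumr; under eq_bigr do rewrite -mulrA mulr_suml.
      rewrite -mulr_sumr exchange_big /=; congr (_ * _); apply: eq_bigr => i _.
      by rewrite mulr_sumr; apply: eq_bigr => j _; rewrite mulrA.
    rewrite -sumrB; apply: eq_bigr => i _; rewrite /jensen_gap.
    by rewrite (mulrBr (_^-1)) mulKf // mulrBr.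
  have -> : alpha * (K%:R / (\sum_k tau k) * jensen_gap tau d)
     = alpha * (K%:R * (ln (\sum_j tau j * d j) - ln (\sum_j tau j)))
       - \sum_j (alpha * (K%:R / (\sum_k tau k) * tau j)) * ln (d j).
    have -> : \sum_j (alpha * (K%:R / (\sum_k tau k) * tau j)) * ln (d j)
        = alpha * (K%:R / (\sum_k tau k)) * \sum_j (tau j * ln (d j)).
      by rewrite mulr_sumr; apply: eq_bigr => j _; rewrite !mulrA.
    by rewrite /jensen_gap; field.
  rewrite /gap addrACA -!addrA; congr (_ + (_ + _)).
  rewrite -opprD; congr (- _); rewrite -big_split /= mulr_sumr.
  apply: eq_bigr => j _; rewrite -mulrDl; congr (_ * _).
  (* The diagonal equation enters here, as an expression for the factor 1. *)
  rewrite -[LHS]mulr1 [X in _ * X = _](hdiag j); field.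
  by rewrite !gt_eqF.
have c0 : 0 < K%:R / N%:R :> R by rewrite divr_gt0.
have p1 i : 0 <= K%:R / N%:R * ((\sum_k a i k)^-1 * jensen_gap (a i) d).
  by rewrite mulr_ge0 ?(ltW c0) // mulr_ge0 ?invr_ge0 ?(ltW (s0 i)) //; case: (ga i).
have p2 : 0 <= alpha * (K%:R / (\sum_k tau k) * jensen_gap tau d).
  rewrite mulr_ge0 // mulr_ge0 //; last by case: gt.
  by rewrite divr_ge0 // ltW.
rewrite gapE; split; first by rewrite addr_ge0 // sumr_ge0.
move=> /eqP; rewrite paddr_eq0 ?sumr_ge0 // => /andP[/eqP /psumr_eq0P h1 /eqP h2].
split=> [i|al j].
  apply: (ga i).2; have /eqP := h1 (fun i _ => p1 i) i isT.
  by rewrite !mulf_eq0 !invr_eq0 (gt_eqF K0) (gt_eqF N0) (negPf (sn i)) => /eqP.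
apply: gt.2; last by rewrite gt_eqF.
by move/eqP: h2; rewrite !mulf_eq0 !invr_eq0 (gt_eqF al) (gt_eqF K0) (negPf tn) => /eqP.
Qed.

Lemma det_inv_congr n (F A : 'M[R]_n) (d : 'rV[R]_n) :
  A \in unitmx -> F^T *m invmx A *m F = diag_mx d ->
  \det F ^+ 2 = \det A * \prod_j d 0 j.
Proof.
move=> uA /(congr1 determinant); rewrite !det_mulmx det_tr det_diag => <-.
by rewrite det_inv; field; rewrite -unitfE -unitmxE.
Qed.

Lemma trace_congr_diag n (F A T : 'M[R]_n) (d : 'rV[R]_n) : F \in unitmx ->
  F^T *m A *m F = diag_mx d ->
  \tr (A *m T) = \sum_j (invmx F *m T *m (invmx F)^T) j j * d 0 j.
Proof.
move=> uF hd.
have -> : A = (invmx F)^T *m diag_mx d *m invmx F.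
  rewrite -hd !mulmxA -trmx_mul mulmxV // trmx1 mul1mx -mulmxA mulmxV //.
  by rewrite mulmx1.
rewrite -!mulmxA mxtrace_mulC -!mulmxA /mxtrace; apply: eq_bigr => j _.
by rewrite mul_diag_mx mxE mulrC !mulmxA.
Qed.

Lemma quadform_congr_diag n (F A : 'M[R]_n) (d : 'rV[R]_n) v : F \in unitmx ->
  F^T *m A *m F = diag_mx d ->
  quadform A v = \sum_j ((invmx F *m v) j 0) ^+ 2 * d 0 j.
Proof.
move=> uF hd; rewrite -{1}[v](mulKVmx uF) -quadform_congr hd quadform_diag.
by apply: eq_bigr => j _; rewrite mulrC.
Qed.

Lemma outer_diag n (H : 'M[R]_n) (v : 'cV[R]_n) j :
  (H *m (v *m v^T) *m H^T) j j = ((H *m v) j 0) ^+ 2.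
Proof.
have -> : H *m (v *m v^T) *m H^T = (H *m v) *m (H *m v)^T by rewrite trmx_mul !mulmxA.
by rewrite mxE big_ord1 [in X in _ * X]mxE expr2.
Qed.

Lemma sum_col n (F : 'M[R]_n) (v : 'cV[R]_n) : F *m v = \sum_j v j 0 *: col j F.
Proof.
apply/colP => i; rewrite mxE summxE; apply: eq_bigr => j _.
by rewrite !mxE mulrC.
Qed.

(* Without regularization, the generalized eigenvectors of a single eigenvalue
   span a subspace that violates the bound on the proportion of samples unless
   that eigenvalue is the only one. *)
Lemma single_eigenvalue x (F : 'M[R]_K) (a : 'I_N -> 'I_K -> R) (d : 'I_K -> R) :
  (forall i, x i != 0) ->
  (forall S, proper_subspace S -> proportion x S < (\dim S)%:R / K%:R) ->
  (forall i, x i = \sum_j a i j *: col j F) ->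
  (forall i, 0 < \sum_j a i j ^+ 2) ->
  (forall j, 1 = K%:R / N%:R * (\sum_i (\sum_k a i k ^+ 2)^-1 * a i j ^+ 2)) ->
  (forall i j k, a i j != 0 -> a i k != 0 -> d j = d k) ->
  forall j k, d j = d k.
Proof.
move=> hx hS xE s0 hdiag hd.
suff h j0 j : d j = d j0 by move=> j k; rewrite (h j k).
apply/eqP; apply: contraT => jJ.
pose J := [set k | d k == d j0]%SET.
pose S := <<[seq col k F | k <- enum J]>>%VS.
have dimS : (\dim S <= #|J|)%N.
  by rewrite (leq_trans (dim_span _)) // size_map -cardE.
have cardJ : (#|J| < K)%N.
  rewrite -[K in (_ < K)%N]card_ord -cardsT; apply: proper_card.
  by rewrite properT; apply/eqP => /setP/(_ j); rewrite !inE (negPf jJ).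
have J0 : (0 < #|J|)%N by apply/card_gt0P; exists j0; rewrite inE.
(* By [hd], a sample with one nonzero coordinate in [J] has all its nonzero coordinates there. *)
have inS i k : k \in J -> a i k != 0 -> x i \in S.
  move=> kJ aik; rewrite xE rpred_sum // => l _.
  have [->|ail] := eqVneq (a i l) 0; first by rewrite scale0r mem0v.
  rewrite memvZ // memv_span //; apply/mapP; exists l => //.
  by rewrite mem_enum inE (hd i l k ail aik); move: kJ; rewrite inE.
have K0 : 0 < K%:R :> R by rewrite ltr0n.
have N0 : 0 < N%:R :> R by rewrite ltr0n.
(* Sum of the diagonal equations over [J]: each sample contributes the share of its squared length
   carried by [J], which is at most 1 and is 0 outside [S]. *)
have leP : #|J|%:R <= K%:R * proportion x S.
  have -> : #|J|%:R = \sum_(k in J) (1 : R) by rewrite sumr_const.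
  rewrite (eq_bigr _ (fun k _ => hdiag k)) -mulr_sumr exchange_big /=.
  rewrite /proportion mulrA ler_pM2l ?divr_gt0 //; apply: ler_sum => i _.
  rewrite -mulr_sumr; have [xS|xS] := boolP (x i \in S).
    rewrite mulrC ler_pdivrMr // mul1r [leRHS](bigID (mem J)) /= lerDl.
    by apply: sumr_ge0 => k _; apply: sqr_ge0.
  rewrite [X in _ * X]big1 ?mulr0 // => k kJ; apply/eqP; rewrite sqrf_eq0.
  by apply: contraR xS; apply: inS.
have S1 : (1 <= \dim S)%N.
  rewrite lt0n dimv_eq0; apply/eqP => S0; move: leP.
  rewrite /proportion big1 ?mulr0 ?lern0 => [|i _]; first by rewrite eqn0Ngt J0.
  by rewrite S0 memv0 (negPf (hx i)).
have Sp : proper_subspace S.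
  by rewrite /proper_subspace S1 -ltnS prednK // (leq_ltn_trans dimS).
(* The contradiction: [#|J| <= K * proportion x S < \dim S <= #|J|]. *)
have := hS _ Sp; rewrite ltr_pdivlMr // => /(le_lt_trans _) h.
move: leP; rewrite mulrC => /h; rewrite ltr_nat ltnNge dimS.
by [].
Qed.

Lemma solution_minimal (alpha : R) x T Sigma Sigma' :
  posdefmx T -> 0 <= alpha -> (forall i, x i != 0) ->
  (forall S, proper_subspace S ->
    proportion x S < (1 + alpha) * (\dim S)%:R / K%:R) ->
  wiesel_solution alpha x T Sigma -> posdefmx Sigma' ->
  wiesel_loss alpha x T Sigma <= wiesel_loss alpha x T Sigma' /\
  (wiesel_loss alpha x T Sigma = wiesel_loss alpha x T Sigma' ->
    exists2 c, 0 < c & Sigma' = c *: Sigma).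
Proof.
move=> hT al0 hx hS [hSig eSig] hSig'.
have iSig := posdef_inv hSig; have iSig' := posdef_inv hSig'.
have uSig := posdef_unitmx hSig; have uSig' := posdef_unitmx hSig'.
have [F [d [uF FA FB]]] := simultaneous_diagonalization iSig iSig'.1.
have FA' : F^T *m invmx Sigma *m F = diag_mx (const_mx 1) by rewrite FA diag_const_mx.
pose H := invmx F.
(* Congruence by [H] turns the left-hand side of the equation into the identity; its diagonal then
   yields [hdiag]. *)
have HSH : H *m Sigma *m H^T = 1%:M.
  have SF : Sigma = F *m F^T.
    have e : (invmx Sigma *m F) *m F^T = 1%:M by apply: mulmx1C; rewrite mulmxA.
    by rewrite -[LHS]mulmx1 -e !mulmxA mulmxV // mul1mx.
  by rewrite SF /H !mulmxA mulVmx // mul1mx -trmx_mul mulVmx // trmx1.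
pose y i := H *m x i.
pose a i j := y i j 0 ^+ 2.
pose tau j := (H *m T *m H^T) j j.
have a0 i j : 0 <= a i j by exact: sqr_ge0.
have tau0 j : 0 < tau j.
  apply: posdef_diag_gt0; rewrite -{1}[H]trmxK; apply: posdef_congr => //.
  by rewrite unitmx_tr unitmx_inv.
have d0 j : 0 < d 0 j.
  have /matrixP/(_ j j) := FB; rewrite [RHS]mxE eqxx mulr1n => <-.
  by apply: posdef_diag_gt0; exact: posdef_congr.
have qS i : quadform (invmx Sigma) (x i) = \sum_j a i j.
  by rewrite (quadform_congr_diag _ uF FA'); apply: eq_bigr => j _;
    rewrite [X in _ * X]mxE mulr1.
have qS' i : quadform (invmx Sigma') (x i) = \sum_j a i j * d 0 j.
  by rewrite (quadform_congr_diag _ uF FB).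
have tS : \tr (invmx Sigma *m T) = \sum_j tau j.
  by rewrite (trace_congr_diag _ uF FA'); apply: eq_bigr => j _;
    rewrite [X in _ * X]mxE mulr1.
have tS' : \tr (invmx Sigma' *m T) = \sum_j tau j * d 0 j.
  by rewrite (trace_congr_diag _ uF FB).
have s0 i : 0 < \sum_j a i j by rewrite -qS iSig.2.
have hdiag j : 1 = 1 / (1 + alpha) * (K%:R / N%:R) * (\sum_i (\sum_k a i k)^-1 * a i j)
       + alpha / (1 + alpha) * (K%:R / (\sum_k tau k) * tau j).
  have e : (H *m Sigma *m H^T) j j = 1 by rewrite HSH mxE eqxx.
  rewrite -[LHS]e.
  rewrite [in LHS]eSig /tyler_map mulmxDr mulmxDl mxE; congr (_ + _).
    rewrite -scalemxAr -scalemxAl mxE mulmx_sumr mulmx_suml summxE; congr (_ * _).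
    by apply: eq_bigr => i _; rewrite -scalemxAr -scalemxAl mxE outer_diag qS.
  by rewrite -!scalemxAr -!scalemxAl mxE [X in _ * X]mxE tS.
have [g0 gE] := diagonal_gap al0 a0 s0 tau0 d0 hdiag.
have dS := posdef_det_gt0 hSig; have dS' := posdef_det_gt0 hSig'.
have lndet : ln (\det Sigma') = ln (\det Sigma) - \sum_j ln (d 0 j).
  have P0 : 0 < \prod_j d 0 j by apply: prodr_gt0.
  have := det_inv_congr uSig' FB; rewrite (det_inv_congr uSig FA').
  rewrite big1 => [|j _]; last by rewrite mxE.
  rewrite mulr1 => ->; rewrite lnM ?posrE //.
  have -> : \sum_j ln (d 0 j) = ln (\prod_j d 0 j); last by rewrite addrK.
  (* Positivity of the partial products travels with the induction, because [lnM] needs it. *)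
  pose P (s p : R) := 0 < p /\ s = ln p.
  suff [] : P (\sum_j ln (d 0 j)) (\prod_j d 0 j) by [].
  apply: (big_rec2 P); rewrite /P; first by rewrite ln1 ltr01.
  by move=> j p s _ [p0 ->]; rewrite mulr_gt0 // lnM ?posrE.
set gap := (X in 0 <= X) in g0 gE.
have lossE : wiesel_loss alpha x T Sigma' - wiesel_loss alpha x T Sigma = gap.
  rewrite /wiesel_loss /gap lndet tS tS' (eq_bigr _ (fun i _ => congr1 (@ln R) (qS i))).
  rewrite (eq_bigr _ (fun i _ => congr1 (@ln R) (qS' i))) sumrB; ring.
split; first by rewrite -subr_ge0 lossE.
move=> /esym /eqP; rewrite -subr_eq0 lossE => /eqP /gE [ga gt].
(* Constant eigenvalues make [invmx Sigma'] equal to [c *: invmx Sigma], whence the factor [c^-1]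
   for [Sigma']. *)
suff [c dc] : exists c, forall j, d 0 j = c.
  have c0 : 0 < c by rewrite -(dc (Ordinal hK)).
  exists c^-1; first by rewrite invr_gt0.
  have e : invmx Sigma' = c *: invmx Sigma.
    have : F^T *m invmx Sigma' *m F = F^T *m (c *: invmx Sigma) *m F.
      rewrite FB -scalemxAr -scalemxAl FA; apply/matrixP => i j.
      by rewrite !mxE dc mulr_natr.
    have uFT : F^T \in unitmx by rewrite unitmx_tr.
    by move/(can_inj (mulmxK uF))/(can_inj (mulKmx uFT)).
  by rewrite -[Sigma']invmxK e invmxZ ?invmxK // unitmxZ ?unitmx_inv // unitfE gt_eqF.
have [al|] := ltrP 0 alpha; first by eexists => j; exact: gt.
move=> alle; have al : alpha = 0 by apply/eqP; rewrite eq_le alle.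
exists (d 0 (Ordinal hK)) => j.
apply: (@single_eigenvalue x F (fun i j => y i j 0) (fun j => d 0 j)) => //.
- by move=> S /hS; rewrite al addr0 mul1r.
- by move=> i; rewrite -sum_col /y mulKVmx.
- by move=> k; rewrite {1}(hdiag k) al addr0 !mul0r addr0 divr1 mul1r.
- by move=> i k l ak al'; rewrite (ga i k) ?(ga i l) // /a sqrf_eq0.
Qed.

End Minimality.

(** * Coercivity of the dual functional *)

Section RankOne.
Context {R : realType} {n : nat}.
Implicit Types (M : 'M[R]_n) (p q v y : 'cV[R]_n).

(** The two block upper triangular matrices below are conjugate by a unit lower triangular one, so
    their determinants agree. *)
Lemma det_1_add_outer p q : \det (1%:M + p *m q^T) = 1 + (q^T *m p) 0 0.
Proof.
have : block_mx 1%:M 0 p 1%:M *m block_mx 1%:M (- q^T) 0 (1%:M + p *m q^T)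
    = block_mx (1%:M + q^T *m p) (- q^T) 0 1%:M *m block_mx 1%:M 0 p 1%:M.
  rewrite !mulmx_block !mul1mx !mulmx1 !mul0mx !mulmx0 !addr0 !add0r mulmxN mulNmx.
  by congr block_mx; rewrite ?addrK // addrCA addNr addr0.
move/(congr1 determinant); rewrite !det_mulmx !det_ublock !det_lblock !det1.
rewrite !mul1r !mulr1 => ->.
by rewrite [X in \det X]mx11_scalar det_scalar1 !mxE eqxx.
Qed.

Lemma det_add_outer M c v : M \in unitmx ->
  \det (M + c *: (v *m v^T)) = \det M * (1 + c * quadform (invmx M) v).
Proof.
move=> uM; have -> : M + c *: (v *m v^T) = M *m (1%:M + (c *: (invmx M *m v)) *m v^T).
  by rewrite mulmxDr mulmx1 -scalemxAl -scalemxAr -mulmxA mulKVmx.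
by rewrite det_mulmx det_1_add_outer -scalemxAr mxE mulmxA.
Qed.

(* Cauchy-Schwarz for the inner product defined by M, applied to y and M^-1 v. *)
Lemma quadform_inv_ge M v y : posdefmx M -> (y^T *m v) 0 0 = 1 ->
  (quadform M y)^-1 <= quadform (invmx M) v.
Proof.
move=> hM yv; have uM := posdef_unitmx hM.
have y0 : y != 0.
  by apply/eqP => y0; move/eqP: yv; rewrite y0 trmx0 mul0mx mxE eq_sym oner_eq0.
have q0 : 0 < quadform M y by exact: hM.2.
(* This vector is [M^-1 v] minus its [M]-orthogonal projection onto [y]; its form is the difference
   of the two sides. *)
have := posdef_quadform_ge0 (- (quadform M y)^-1 *: y + invmx M *m v) hM.
rewrite quadformDr ?hM.1 // quadformZr.
have -> : ((- (quadform M y)^-1 *: y)^T *m M *m (invmx M *m v)) 0 0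
    = - (quadform M y)^-1.
  by rewrite -mulmxA mulKVmx // [(_ *: y)^T]linearZ /= -scalemxAl mxE yv mulr1.
have -> : quadform M (invmx M *m v) = quadform (invmx M) v.
  by rewrite -quadform_congr trmx_inv hM.1 mulVmx // mul1mx.
have -> : (- (quadform M y)^-1) ^+ 2 * quadform M y = (quadform M y)^-1.
  by field; rewrite gt_eqF.
set a := _^-1; move=> h; lra.
Qed.

(** The map [u - projv S u] kills [S] but not [v]. Some coordinate of it is nonzero at [v]; [y]
    represents that coordinate, normalized at [v]. *)
Lemma vspace_annihilator (S : {vspace 'cV[R]_n}) v : v \notin S ->
  exists y, (forall u, u \in S -> (y^T *m u) 0 0 = 0) /\ (y^T *m v) 0 0 = 1.
Proof.
move=> vS; pose g u := u - projv S u.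
have gS u : u \in S -> g u = 0 by move=> uS; rewrite /g projv_id // subrr.
have gv : g v != 0.
  apply: contra vS; rewrite subr_eq0 => /eqP ->; exact: memv_proj.
have [k gk] : exists k, g v k 0 != 0.
  apply/existsP; apply: contraR gv => /existsPn h; apply/eqP/colP => k.
  by have /negPn/eqP -> := h k; rewrite mxE.
exists (\col_j (g (delta_mx j 0) k 0 / g v k 0)).
have yE u : ((\col_j (g (delta_mx j 0) k 0 / g v k 0))^T *m u) 0 0 = g u k 0 / g v k 0.
  have gu : g u = \sum_j u j 0 *: g (delta_mx j 0).
    rewrite {1}/g {1 2}[u]matrix_sum_delta; under eq_bigr do rewrite big_ord1.
    rewrite linear_sum -sumrB; apply: eq_bigr => j _.
    by rewrite linearZ /= -scalerBr.
  rewrite gu summxE mulr_suml mxE; apply: eq_bigr => j _.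
  by rewrite !mxE mulrC -mulrA.
by split=> [u uS|]; rewrite yE ?divff // gS // mxE mul0r.
Qed.

Lemma posdef_add_outer M c v : posdefmx M -> 0 <= c -> posdefmx (M + c *: (v *m v^T)).
Proof.
move=> hM c0; split=> [|u u0].
  by rewrite linearD linearZ /= trmx_mul trmxK hM.1.
rewrite quadformDl quadformZl quadform_outer ltr_pwDl ?hM.2 //.
by rewrite mulr_ge0 ?sqr_ge0.
Qed.

End RankOne.

(** * Growth of the determinant and Abel summation over sorted weights *)

Section Coercivity.
Context {R : realType} {K N : nat} (x : 'I_N -> 'cV[R]_K).
Implicit Types (s : seq 'I_N) (l u : 'I_N -> R).

Definition family_span s : {vspace 'cV[R]_K} := <<[seq x i | i <- s]>>%VS.

(* The head of the list is the last vector added to the family, so the lists of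
   interest are sorted by increasing l. *)
Fixpoint abel_sum (b : seq 'I_N -> R) l s : R :=
  if s is j :: s' then abel_sum b l s' + (b s - b s') * l j else 0.

(* If y is orthogonal to the earlier vectors and y^T x_j = 1, the new factor
   1 + u_j x_j^T M^-1 x_j is at least 1 + u_j / (y^T M y), and y^T M y = y^T M0 y
   does not depend on u. *)
Lemma det_growth (M0 : 'M[R]_K) s : posdefmx M0 ->
  exists C : R, forall u, (forall i, 0 <= u i) ->
    let M := M0 + \sum_(i <- s) u i *: (x i *m (x i)^T) in
    posdefmx M /\
    abel_sum (fun s => (\dim (family_span s))%:R) (fun i => ln (1 + u i)) s - C
      <= ln (\det M).
Proof.
move=> hM0; elim: s => [|j s [C IH]].
  exists (- ln (\det M0)) => u u0 /=.
  by rewrite big_nil addr0 add0r opprK.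
have pos u : (forall i, 0 <= u i) -> let M := M0 + \sum_(i <- s) u i *: (x i *m (x i)^T) in
    posdefmx M /\
    ln (\det (M + u j *: (x j *m (x j)^T)))
      = ln (\det M) + ln (1 + u j * quadform (invmx M) (x j)).
  move=> u0 M; have [hM _] := IH u u0; split=> //.
  rewrite det_add_outer ?posdef_unitmx // lnM ?posrE //; first exact: posdef_det_gt0.
  rewrite ltr_pwDl // mulr_ge0 //; apply: posdef_quadform_ge0; exact: posdef_inv.
have spanE : family_span (j :: s) = (<[x j]> + family_span s)%VS.
  by rewrite /family_span /= span_cons.
(* If [x j] is already in the span, the dimension is unchanged and it is enough that the new factor
   is at least 1. *)
have [xS|xS] := boolP (x j \in family_span s).
  exists C => u u0 M; have [hM lnM] := pos u u0; have [_ ineq] := IH u u0.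
  have -> : M = M0 + \sum_(i <- s) u i *: (x i *m (x i)^T) + u j *: (x j *m (x j)^T).
    by rewrite /M big_cons [X in _ + X]addrC addrA.
  split; first exact: posdef_add_outer.
  rewrite lnM /= spanE; have -> : (<[x j]> + family_span s = family_span s)%VS.
    by apply/addv_idPr; rewrite -memvE.
  rewrite subrr mul0r addr0 (le_trans ineq) // lerDl ln_ge0 // lerDl mulr_ge0 //.
  by apply: posdef_quadform_ge0; exact: posdef_inv.
have [y [yS yx]] := vspace_annihilator xS.
have y0 : y != 0.
  by apply/eqP => y0; move/eqP: yx; rewrite y0 trmx0 mul0mx mxE eq_sym oner_eq0.
pose k : R := (quadform M0 y)^-1.
have k0 : 0 < k by rewrite invr_gt0 hM0.2.
(* With [m] below both 1 and [k], the new factor is at least [m * (1 + u j)]; [C] absorbs [ln m]. *)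
pose m := Num.min 1 k.
have m0 : 0 < m by rewrite lt_min ltr01.
exists (C - ln m) => u u0 M; have [hM lnM'] := pos u u0; have [_ ineq] := IH u u0.
have -> : M = M0 + \sum_(i <- s) u i *: (x i *m (x i)^T) + u j *: (x j *m (x j)^T).
  by rewrite /M big_cons [X in _ + X]addrC addrA.
split; first exact: posdef_add_outer.
rewrite lnM' /= spanE.
have -> : \dim (<[x j]> + family_span s) = (\dim (family_span s)).+1.
  rewrite dimv_disjoint_sum; last first.
    apply/eqP; rewrite -subv0; apply/subvP => v; rewrite memv_cap memv0.
    case/andP=> /vlineP[a ->]; have [->|a0 aS] := eqVneq a 0; first by rewrite scale0r.
    by case/negP: xS; rewrite -[x j](scalerK a0) memvZ.
  rewrite dim_vline; have -> : x j != 0; last by rewrite add1n.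
  by apply: contraNneq xS => ->; rewrite mem0v.
rewrite -[in _.+1%:R]addn1 natrD.
have -> (a : R) : a + 1 - a = 1 by ring.
rewrite mul1r.
have -> (p q r t : R) : p + q - (r - t) = (p - r) + (t + q) by ring.
rewrite lerD // -lnM ?posrE ?ltr_pwDl //.
have ge0 := u0 j.
have uq : m * (1 + u j)
    <= 1 + u j * quadform (invmx (M0 + \sum_(i <- s) u i *: (x i *m (x i)^T))) (x j).
  have mq : m <= quadform (invmx (M0 + \sum_(i <- s) u i *: (x i *m (x i)^T))) (x j).
    apply: le_trans (quadform_inv_ge hM yx); rewrite quadformDl quadform_sum big_seq.
    rewrite big1 ?addr0 => [|i is_]; first by rewrite /m ge_min lexx orbT.
    rewrite quadformZl quadform_outer.
    have -> : ((x i)^T *m y) 0 0 = (y^T *m x i) 0 0.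
      by rewrite -[RHS]trmx11E trmx_mul trmxK.
    by rewrite yS ?expr0n ?mulr0 // memv_span // map_f.
  rewrite mulrDr mulr1 lerD //; first by rewrite /m ge_min lexx.
  by rewrite mulrC ler_wpM2l.
have u1 : 0 < m * (1 + u j) by rewrite mulr_gt0 // ltr_pwDl.
by rewrite ler_ln // posrE // (lt_le_trans u1).
Qed.

(** The Abel sum is linear in [b], and the size grows by one at each step, so its Abel sum is the
    plain sum of [l]. *)
Lemma abel_sum_affine (b : seq 'I_N -> R) beta c l s :
  abel_sum (fun s => beta * b s - c * (size s)%:R) l s
    = beta * abel_sum b l s - c * \sum_(i <- s) l i.
Proof.
elim: s => [|j s /= ->]; first by rewrite big_nil /= !mulr0 subrr.
by rewrite big_cons -[in (size s).+1%:R]addn1 natrD; ring.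
Qed.

Lemma size_uniq_ord s : uniq s -> (size s <= N)%N.
Proof. by move=> /card_uniqP <-; rewrite -[leqRHS](card_ord N) max_card. Qed.

(** Summation by parts leaves a boundary term at the head plus the increments of [l] along the list,
    each times the value of [b] on a proper tail. These values are at least [delta], and the
    increments up to [i] telescope. *)
Lemma abel_sum_ge (b : seq 'I_N -> R) (delta : R) l j s :
  0 <= delta -> b [::] = 0 ->
  (forall s', uniq s' -> (0 < size s' < N)%N -> delta <= b s') ->
  uniq (j :: s) -> sorted (fun i k => l i <= l k) (j :: s) ->
  forall i, i \in j :: s ->
  l j * b (j :: s) + delta * (l i - l j) <= abel_sum b l (j :: s).
Proof.
move=> d0 b0 hb; elim: s j => [|k s IH] j us ss i.
  by rewrite inE => /eqP ->; rewrite /= b0 add0r !subr0 subrr mulr0 addr0 mulrC.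
have us' : uniq (k :: s) by case/andP: us.
have /andP[jk ss'] : (l j <= l k) && sorted (fun i k => l i <= l k) (k :: s) by [].
have bk : delta <= b (k :: s).
  by apply: hb => //=; exact: (size_uniq_ord us).
have step m : m \in k :: s ->
    l j * b [:: j, k & s] + delta * (l m - l j) <= abel_sum b l [:: j, k & s].
  move=> /(IH k us' ss') h.
  rewrite [leRHS]/= -/(abel_sum b l (k :: s)).
  (* Prepending [j] leaves the slack [(l k - l j) * (b (k :: s) - delta)], nonnegative by sortedness
     and [bk]. *)
  have -> : l j * b [:: j, k & s] + delta * (l m - l j)
     = l k * b (k :: s) + delta * (l m - l k) - (l k - l j) * (b (k :: s) - delta)
       + (b [:: j, k & s] - b (k :: s)) * l j by ring.
  rewrite lerD2r (le_trans _ h) // lerBlDr lerDl mulr_ge0 // subr_ge0 //.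
rewrite inE => /orP[/eqP ->|]; last exact: step.
have := step k (mem_head _ _); apply: le_trans.
by rewrite subrr mulr0 addr0 lerDl mulr_ge0 // subr_ge0.
Qed.

(** The least positive value, with 1 as default if there is none. *)
Lemma finite_gap (I : finType) (f : I -> R) :
  exists2 delta : R, 0 < delta & forall i, 0 < f i -> delta <= f i.
Proof.
exists (\big[Num.min/1]_(i | 0 < f i) f i) => [|i fi].
  by elim/big_ind: _ => // a b a0 b0; rewrite lt_min a0.
by rewrite (bigD1 i) //= ge_min lexx.
Qed.

Lemma finite_bound (T : eqType) (ss : seq T) (P : T -> R -> Prop) :
  (forall t C C', C <= C' -> P t C -> P t C') -> (forall t, exists C, P t C) ->
  exists C, forall t, t \in ss -> P t C.
Proof.
move=> mono hP; elim: ss => [|t ss [C hC]]; first by exists 0.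
have [C' hC'] := hP t; exists (Num.max C C') => r; rewrite inE => /orP[/eqP ->|rs].
  by apply: mono hC'; rewrite le_max lexx orbT.
by apply: mono (hC r rs); rewrite le_max lexx.
Qed.

(* In the second case of the disjunction, the boundary term of the Abel
   summation vanishes. *)
Lemma log_det_coercive (M0 : 'M[R]_K) (beta c : R) : posdefmx M0 -> 0 < beta ->
  (forall s, uniq s -> (0 < size s < N)%N ->
     0 < beta * (\dim (family_span s))%:R - c * (size s)%:R) ->
  exists2 delta : R, 0 < delta & exists C : R, forall u, (forall i, 0 <= u i) ->
  (forall s, uniq s -> size s = N ->
     0 < beta * (\dim (family_span s))%:R - c * (size s)%:R)
  \/ (exists j, u j = 0) ->
  forall i, delta * ln (1 + u i) - C
    <= beta * ln (\det (M0 + \sum_i u i *: (x i *m (x i)^T)))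
       - c * \sum_i ln (1 + u i).
Proof.
move=> hM0 beta0 hpos.
pose b s := beta * (\dim (family_span s))%:R - c * (size s)%:R.
(* The excess [b s] depends only on a dimension and a size, so finitely many values occur and one
   [delta] serves all lists. *)
have [delta delta0 hdelta] := finite_gap
  (fun p : 'I_K.+1 * 'I_N.+1 => beta * p.1%:R - c * p.2%:R).
have dimK s : (\dim (family_span s) < K.+1)%N.
  by rewrite ltnS (leq_trans (dimvS (subvf _))) // dimvf /dim /= muln1.
have gap s : uniq s -> 0 < b s -> delta <= b s.
  move=> us bs; have sN : (size s < N.+1)%N by rewrite ltnS size_uniq_ord.
  exact: (hdelta (Ordinal (dimK s), Ordinal sN)).
pose P s C := forall u, (forall i, 0 <= u i) ->
    abel_sum (fun s => (\dim (family_span s))%:R) (fun i => ln (1 + u i)) s - C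
      <= ln (\det (M0 + \sum_(i <- s) u i *: (x i *m (x i)^T))).
(* The order of the weights varies with [u]; a constant valid for every permutation keeps [C]
   independent of [u]. *)
have [C hC] : exists C, forall s, s \in permutations (enum 'I_N) -> P s C.
  apply: finite_bound => [s C C' CC' h u u0|s].
    by apply: le_trans (h u u0); rewrite lerB.
  by have [C hC] := det_growth s hM0; exists C => u /hC[].
exists delta => //; exists (beta * C) => u u0 hu i.
pose l k := ln (1 + u k).
have l0 k : 0 <= l k by rewrite ln_ge0 // lerDl.
pose s := sort (fun i k => l i <= l k) (enum 'I_N).
have ps : perm_eq s (enum 'I_N) by rewrite perm_sort.
have us : uniq s by rewrite (perm_uniq ps) enum_uniq.
have sS : size s = N by rewrite (perm_size ps) size_enum_ord.
have ss : sorted (fun i k => l i <= l k) s by apply: sort_sorted => j k; exact: le_total.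
have is_ k : k \in s by rewrite (perm_mem ps) mem_enum.
have sumE (V : nmodType) (F : 'I_N -> V) : \sum_(k <- s) F k = \sum_k F k.
  by rewrite (perm_big _ ps) big_enum.
have := hC s; rewrite mem_permutations => /(_ ps u u0); rewrite sumE => hdet.
have main : delta * l i <= abel_sum b l s.
  have : exists j s', s = j :: s'.
    by move: (is_ i); case: (s) => // j s'; exists j, s'.
  move=> [j [s' es]].
  have b00 : b [::] = 0 by rewrite /b /family_span /= span_nil dimv0 !mulr0 subrr.
  have hb s'' : uniq s'' -> (0 < size s'' < N)%N -> delta <= b s''.
    by move=> us'' hs''; apply: gap => //; exact: hpos.
  have lj k : l j <= l k.
    move: (is_ k) ss; rewrite es inE => /orP[/eqP -> //|ks'].
    rewrite /sorted path_sortedE; last by move=> ? ? ?; exact: le_trans.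
    by case/andP => /allP/(_ k ks').
  move: us ss (is_ i); rewrite es => us ss ii.
  have := abel_sum_ge (ltW delta0) b00 hb us ss ii; apply: le_trans.
  have -> (p : R) : l j * p + delta * (l i - l j) = delta * l i + l j * (p - delta) by ring.
  rewrite lerDl.
  case: hu => [full|[k uk]].
    by rewrite mulr_ge0 // subr_ge0 gap // full // -es.
  suff -> : l j = 0 by rewrite mul0r.
  apply/eqP; rewrite eq_le l0 andbT; apply: le_trans (lj k) _.
  by rewrite /l uk addr0 ln1.
rewrite -/(l i); apply: le_trans (lerB main (lexx (beta * C))) _.
rewrite /b abel_sum_affine sumE addrAC lerD2r -mulrBr ler_pM2l //.
Qed.

Context (hK : (0 < K)%N) (hN : (0 < N)%N) (hx : forall i, x i != 0).
Context (alpha : R).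
Context (alpha_ge0 : 0 <= alpha) (hS : forall S, proper_subspace S ->
  proportion x S < (1 + alpha) * (\dim S)%:R / K%:R).

(** At least [size s] samples lie in the span, so (ii) applies if the span is proper. If it is the
    whole space, strictness comes from [size s < N] or from [0 < alpha]. *)
Lemma family_span_excess s : uniq s -> (0 < size s)%N ->
  (size s < N)%N || (0 < alpha) ->
  0 < (1 + alpha) * (\dim (family_span s))%:R - K%:R / N%:R * (size s)%:R.
Proof.
move=> us s0 hs; have K0 : 0 < K%:R :> R by rewrite ltr0n.
have N0 : 0 < N%:R :> R by rewrite ltr0n.
have sN := size_uniq_ord us.
have dimK : (\dim (family_span s) <= K)%N.
  by rewrite (leq_trans (dimvS (subvf _))) // dimvf /dim /= muln1.
rewrite subr_gt0; move: dimK; rewrite leq_eqVlt => /orP[/eqP ->|dimK].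
  rewrite mulrAC ltr_pdivrMr // [_ * K%:R]mulrC -mulrA ltr_pM2l //.
  case/orP: hs => [sN'|al].
    apply: (@lt_le_trans _ _ N%:R); first by rewrite ltr_nat.
    by rewrite ler_peMl ?ler0n // lerDl.
  apply: (@le_lt_trans _ _ N%:R); first by rewrite ler_nat.
  by rewrite ltr_pMl // ltrDl.
have inS i : i \in s -> x i \in family_span s.
  by move=> si; apply: memv_span; apply: map_f.
have Sp : proper_subspace (family_span s).
  rewrite /proper_subspace -[X in _ && X]ltnS prednK // dimK andbT lt0n dimv_eq0.
  case: (s) s0 inS => // j s' _ /(_ j (mem_head _ _)) h; apply: contra (hx j) => /eqP e.
  by move: h; rewrite e memv0.
have := hS Sp; rewrite ltr_pdivlMr //; apply: le_lt_trans.
rewrite /proportion [K%:R / _]mulrC -!mulrA ler_pM2l ?invr_gt0 // mulrC ler_pM2r //.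
rewrite [leRHS](bigID (mem s)) /= -[leLHS]addr0 lerD ?sumr_ge0 //.
rewrite -big_uniq // (eq_big_seq (fun=> 1)) => [|i /inS -> //].
by rewrite big_const_seq count_predT iter_addr_0.
Qed.

(** A smaller span would be a proper subspace containing every sample, with proportion 1, against
    (ii). *)
Lemma family_span_full s : alpha = 0 -> uniq s -> size s = N ->
  family_span s = fullv.
Proof.
move=> al us sN; apply/eqP; rewrite eqEdim subvf dimvf /dim /= muln1 leqNgt.
apply/negP => dimK; have K0 : 0 < K%:R :> R by rewrite ltr0n.
have N0 : 0 < N%:R :> R by rewrite ltr0n.
have inS i : x i \in family_span s.
  apply: memv_span; apply: map_f; have := uniq_min_size us => h.
  by have [_ ->] : (size s = size (enum 'I_N)) * (s =i enum 'I_N);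
    [apply: h => [k _|]; rewrite ?mem_enum // size_enum_ord sN|rewrite mem_enum].
have Sp : proper_subspace (family_span s).
  rewrite /proper_subspace -[X in _ && X]ltnS prednK // dimK andbT lt0n dimv_eq0.
  apply: contra (hx (Ordinal hN)) => /eqP e.
  by move: (inS (Ordinal hN)); rewrite e memv0.
have := hS Sp; rewrite /proportion (eq_bigr (fun=> 1)) => [|i _]; last by rewrite inS.
rewrite sumr_const card_ord al addr0 mul1r mulVf ?gt_eqF // ltr_pdivlMr // mul1r.
by rewrite ltr_nat ltnNge (ltnW dimK).
Qed.

(** A vector in the kernel of the form is orthogonal to all samples, which span the space. This
    matrix replaces [alpha *: T] as the base point of the coercivity bound. *)
Lemma posdef_outer_sum : alpha = 0 ->
  posdefmx (\sum_i x i *m (x i)^T).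
Proof.
move=> al; split=> [|v v0].
  by rewrite linear_sum; apply: eq_bigr => i _; rewrite /= trmx_mul trmxK.
rewrite quadform_sum; under eq_bigr do rewrite quadform_outer.
rewrite lt_def sumr_ge0 ?andbT; last by move=> i _; apply: sqr_ge0.
apply: contra v0 => /eqP /psumr_eq0P h.
have xv i : (v^T *m x i) 0 0 = 0.
  rewrite -trmx11E trmx_mul trmxK; apply/eqP; rewrite -sqrf_eq0; apply/eqP.
  by apply: h => // k _; apply: sqr_ge0.
have : v \in family_span (enum 'I_N).
  by rewrite family_span_full ?memvf ?enum_uniq ?size_enum_ord.
move=> /(coord_span (X := in_tuple _)) ev.
have qv : quadform 1%:M v = 0.
  rewrite /quadform mulmx1 {2}ev mulmx_sumr summxE big1 // => k _.
  rewrite -scalemxAr mxE (nth_map (Ordinal hN)) ?xv ?mulr0 //.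
  by rewrite -(size_map x); exact: ltn_ord.
apply/eqP; apply: contra_eq qv => v0; rewrite gt_eqF //.
exact: quadform1_gt0.
Qed.

End Coercivity.

(** * Existence of a solution *)

Section CriticalPoint.
Context {R : realType}.

(* The argument s = - D / m, with D := p q - c e, contradicts the hypothesis if
   D != 0, using 1 - 1 / t <= ln t <= t - 1. *)
Lemma log_critical (p c q e r : R) : 0 < p -> 0 < c -> 0 <= q -> 0 < e -> 0 < r ->
  (forall s, `|s| < r -> 0 < 1 + s * q -> 0 < 1 + s * e ->
     0 <= p * ln (1 + s * q) - c * ln (1 + s * e)) ->
  p * q = c * e.
Proof.
move=> p0 c0 q0 e0 r0 h; apply/eqP; rewrite -subr_eq0; apply: contraT.
set D := _ - _ => D0.
have aD : 0 < `|D| by rewrite normr_gt0.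
have E0 : 0 <= p * q * e by rewrite !mulr_ge0 // ltW.
(* Each summand serves one requirement on [s]: [|s| < r], [|s| * q < 1], [|s| * e < 1], and the
   dominance of the first-order term [s * D]; the final 1 makes them strict. *)
pose m := `|D| / r + `|D| * q + `|D| * e + p * q * e + 1.
have Dr : 0 < `|D| / r by rewrite divr_gt0.
have Dq : 0 <= `|D| * q by rewrite mulr_ge0.
have De : 0 < `|D| * e by rewrite mulr_gt0.
have m0 : 0 < m by rewrite /m; lra.
pose s := - D / m.
have as_ : `|s| = `|D| / m by rewrite normrM normrN normfV (gtr0_norm m0).
have sr : `|s| < r.
  by rewrite as_ ltr_pdivrMr // mulrC -ltr_pdivrMr // /m; lra.
have bound z : 0 <= z -> `|D| * z < m -> 0 < 1 + s * z.
  move=> z0 zm; have : `|s * z| < 1.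
    by rewrite normrM as_ (ger0_norm z0) mulrAC ltr_pdivrMr // mul1r.
  by rewrite ltr_norml => /andP[]; lra.
have sq : 0 < 1 + s * q by apply: bound => //; rewrite /m; lra.
have se : 0 < 1 + s * e by apply: bound; rewrite ?(ltW e0) // /m; lra.
have := h s sr sq se.
have l1 : p * ln (1 + s * q) <= p * (s * q).
  by rewrite ler_pM2l //; have := ln_le_sub1 sq; lra.
have l2 : c * (1 - (1 + s * e)^-1) <= c * ln (1 + s * e).
  rewrite ler_pM2l //; have := @ln_le_sub1 _ (1 + s * e)^-1.
  by rewrite invr_gt0 lnV ?posrE // => /(_ se); lra.
have key : p * (s * q) - c * (1 - (1 + s * e)^-1) = s * (D + p * q * e * s) / (1 + s * e).
  by rewrite /D; field; rewrite gt_eqF.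
have : s * (D + p * q * e * s) / (1 + s * e) < 0.
  rewrite pmulr_llt0 ?invr_gt0 //.
  have -> : s * (D + p * q * e * s) = - (D ^+ 2 * (m - p * q * e) / m ^+ 2).
    by rewrite /s; field; rewrite gt_eqF.
  rewrite oppr_lt0 divr_gt0 ?exprn_gt0 // mulr_gt0 //.
    by rewrite lt_def sqr_ge0 andbT sqrf_eq0.
  by rewrite /m; lra.
lra.
Qed.

End CriticalPoint.

(** * The dual functional, its minimizer and the resulting solution *)

Section Existence.
Context {R : realType} {K N : nat} (x : 'I_N -> 'cV[R]_K) (T : 'M[R]_K).
Local Open Scope classical_set_scope.
Local Open Scope ring_scope.
Context (hK : (0 < K)%N) (hN : (0 < N)%N) (hx : forall i, x i != 0).
Context (hT : posdefmx T).
Context (alpha : R).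
Context (alpha_ge0 : 0 <= alpha) (hS : forall S, proper_subspace S ->
  proportion x S < (1 + alpha) * (\dim S)%:R / K%:R).

Definition weighted_scatter (w : 'I_N -> R) : 'M[R]_K :=
  alpha *: T + \sum_i w i *: (x i *m (x i)^T).

Definition dual_loss (w : 'I_N -> R) : R :=
  (1 + alpha) * ln (\det (weighted_scatter w)) - K%:R / N%:R * \sum_i ln (w i).

Lemma posdef_weighted_scatter w : (forall i, 0 < w i) ->
  posdefmx (weighted_scatter w).
Proof.
move=> w0; split=> [|v v0].
  rewrite linearD linearZ /= hT.1 linear_sum; congr (_ + _); apply: eq_bigr => i _.
  by rewrite /= linearZ /= trmx_mul trmxK.
have s0 i : 0 <= quadform (w i *: (x i *m (x i)^T)) v.
  by rewrite quadformZl quadform_outer mulr_ge0 ?sqr_ge0 // ltW.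
rewrite quadformDl quadform_sum quadformZl.
move: alpha_ge0; rewrite le_eqVlt => /orP[/eqP al|al]; last first.
  by rewrite ltr_pwDl ?sumr_ge0 // mulr_gt0 // hT.2.
rewrite -al mul0r add0r lt_def sumr_ge0 ?andbT //.
apply/eqP => /psumr_eq0P h.
have := (posdef_outer_sum hK hN hx hS (esym al)).2 v v0.
rewrite quadform_sum big1 ?ltxx // => i _.
have /eqP := h (fun i _ => s0 i) i isT.
by rewrite quadformZl mulf_eq0 gt_eqF //= => /eqP.
Qed.

Let b0 : 0 < 1 + alpha.
Proof. by rewrite ltr_pwDl. Qed.
Let K0 : 0 < K%:R :> R.
Proof. by rewrite ltr0n. Qed.
Let N0 : 0 < N%:R :> R.
Proof. by rewrite ltr0n. Qed.
Let c0 : 0 < K%:R / N%:R :> R.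
Proof. by rewrite divr_gt0. Qed.

Let span_proper s : uniq s -> (0 < size s < N)%N ->
  0 < (1 + alpha) * (\dim (family_span x s))%:R - K%:R / N%:R * (size s)%:R.
Proof.
by move=> us /andP[s0 sN]; apply: (family_span_excess hK hN hx alpha_ge0 hS); rewrite ?sN.
Qed.

(** Weights worse than the constant 1 are replaced by it. For the others, coercivity bounds each
    weight above, and the discrepancy between [ln (1 + w k)] and [ln (w k)] bounds it below. *)
Lemma dual_sublevel_regularized : 0 < alpha ->
  exists b B, [/\ 0 < b, b <= B & forall w, (forall i, 0 < w i) ->
    exists w', (forall i, b <= w' i <= B) /\ dual_loss w' <= dual_loss w].
Proof.
move=> al; have hM0 := posdef_scale al hT.
have [delta d0 [C hC]] := log_det_coercive hM0 b0 span_proper.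
pose phi1 := dual_loss (fun=> 1).
pose b := Num.min 1 (expR (- ((phi1 + C) / (K%:R / N%:R)))).
pose B := Num.max 1 (expR ((phi1 + C) / delta)).
exists b, B; have b1 : b <= 1 by rewrite ge_min lexx.
have B1 : 1 <= B by rewrite le_max lexx.
split=> [||w w0]; first by rewrite lt_min ltr01 expR_gt0.
  exact: le_trans B1.
have [hw|hw] := ltrP phi1 (dual_loss w).
  by exists (fun=> 1); split=> [i|]; [rewrite b1|rewrite ltW].
exists w; split=> // i.
have l0 k : 0 <= ln (1 + w k) by rewrite ln_ge0 // lerDl ltW.
have lw k : ln (w k) <= ln (1 + w k).
  by rewrite ler_ln ?posrE // ?ltr_pwDl // ?(ltW (w0 k)) // lerDr.
have := hC w (fun i => ltW (w0 i)) _ i; rewrite -/(weighted_scatter w).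
move=> /(_ (or_introl _)) h.
have {h}h1 : delta * ln (1 + w i) - C <= dual_loss w
    - K%:R / N%:R * \sum_k (ln (1 + w k) - ln (w k)).
  rewrite sumrB /dual_loss; apply: le_trans (h _) _; last by lra.
  move=> s us sN; apply: (family_span_excess hK hN hx alpha_ge0 hS) => //.
    by rewrite sN.
  by rewrite al orbT.
have t0 k : 0 <= ln (1 + w k) - ln (w k) by rewrite subr_ge0.
have ti : ln (1 + w i) - ln (w i) <= \sum_k (ln (1 + w k) - ln (w k)).
  by rewrite [leRHS](bigD1 i) //= lerDl sumr_ge0.
have ct : K%:R / N%:R * (ln (1 + w i) - ln (w i))
    <= K%:R / N%:R * \sum_k (ln (1 + w k) - ln (w k)) by rewrite ler_pM2l.
have ct0 : 0 <= K%:R / N%:R * (ln (1 + w i) - ln (w i)).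
  by rewrite mulr_ge0 // ltW.
have dl : 0 <= delta * ln (1 + w i) by rewrite mulr_ge0 // ltW.
rewrite /b /B ge_min le_max; apply/andP; split; apply/orP; right.
  rewrite -[w i]lnK ?posrE // ler_expR lerNl ler_pdivlMr // mulrC.
  have : K%:R / N%:R * - ln (w i) <= K%:R / N%:R * (ln (1 + w i) - ln (w i)).
    by rewrite ler_pM2l // lerDr.
  lra.
rewrite -[w i]lnK ?posrE // ler_expR ler_pdivlMr // mulrC.
have : delta * ln (w i) <= delta * ln (1 + w i) by rewrite ler_pM2l.
lra.
Qed.

(** Scaling adds [K * ln a] to the log determinant, and the [N] logarithms, weighted by [K / N],
    take it back. *)
Lemma dual_loss_scale a w : alpha = 0 -> 0 < a -> (forall i, 0 < w i) ->
  dual_loss (fun i => a * w i) = dual_loss w.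
Proof.
move=> al a0 w0; rewrite /dual_loss.
have -> : weighted_scatter (fun i => a * w i) = a *: weighted_scatter w.
  rewrite /weighted_scatter al scale0r !add0r scaler_sumr.
  by apply: eq_bigr => i _; rewrite scalerA.
have dw := posdef_det_gt0 (posdef_weighted_scatter w0).
rewrite detZ lnM ?posrE ?exprn_gt0 // lnXn //.
rewrite (eq_bigr (fun i => ln a + ln (w i))) => [|i _]; last by rewrite lnM ?posrE.
rewrite big_split /= sumr_const card_ord al addr0 -[ln a *+ K]mulr_natr -[ln a *+ N]mulr_natr.
by field; rewrite gt_eqF.
Qed.

(** Scale invariance lets the smallest weight be 1. The excesses [v i - 1] are then nonnegative with
    one of them zero, which is the second case of [log_det_coercive]. *)
Lemma dual_sublevel_unregularized : alpha = 0 ->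
  exists b B, [/\ 0 < b, b <= B & forall w, (forall i, 0 < w i) ->
    exists w', (forall i, b <= w' i <= B) /\ dual_loss w' <= dual_loss w].
Proof.
move=> al; have hM0 := posdef_outer_sum hK hN hx hS al.
have [delta d0 [C hC]] := log_det_coercive hM0 b0 span_proper.
pose phi1 := dual_loss (fun=> 1).
pose B := Num.max 1 (expR ((phi1 + C) / delta)).
exists 1, B; have B1 : 1 <= B by rewrite le_max lexx.
split=> // w w0.
have [hw|hw] := ltrP phi1 (dual_loss w).
  by exists (fun=> 1); split=> [i|]; [rewrite lexx|rewrite ltW].
pose j := [arg min_(j < Ordinal hN) w j]%O.
have jmin i : w j <= w i by rewrite /j; case: arg_minP => // k _; apply.
pose v i := (w j)^-1 * w i.
have vi0 : 0 < (w j)^-1 by rewrite invr_gt0.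
have v1 i : 1 <= v i by rewrite /v mulrC ler_pdivlMr // mul1r.
have vloss : dual_loss v = dual_loss w by exact: dual_loss_scale.
exists v; split; last by rewrite vloss.
move=> i; rewrite v1 /=.
have := hC (fun i => v i - 1) _ _ i.
have -> : \sum_i x i *m (x i)^T + \sum_i (v i - 1) *: (x i *m (x i)^T) = weighted_scatter v.
  rewrite /weighted_scatter al scale0r add0r -big_split /=; apply: eq_bigr => k _.
  by rewrite scalerBl scale1r addrC subrK.
have e k : 1 + (v k - 1) = v k by rewrite addrC subrK.
rewrite e (eq_bigr (fun k => ln (v k)) (fun k _ => congr1 (@ln R) (e k))).
rewrite -/(dual_loss v) vloss => h.
have {}h : delta * ln (v i) - C <= dual_loss w.
  apply: h => [k|]; first by rewrite subr_ge0.
  by right; exists j; rewrite /v mulVf ?subrr // gt_eqF.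
have vp : 0 < v i by apply: lt_le_trans (v1 i).
rewrite /B le_max; apply/orP; right.
rewrite -[v i]lnK ?posrE // ler_expR ler_pdivlMr // mulrC.
lra.
Qed.

Lemma dual_loss_continuous (v : 'rV[R]_N) : (forall i, 0 < v 0 i) ->
  {for v, continuous (fun v : 'rV[R]_N => dual_loss (fun i => v 0 i))}.
Proof.
move=> v0; rewrite /dual_loss.
have cln (f : 'rV[R]_N -> R) : 0 < f v -> {for v, continuous f} ->
    {for v, continuous (fun w => ln (f w))}.
  by move=> fv cf; apply: (@continuous_comp _ _ _ f (@ln R)) => //; exact: continuous_ln.
apply: (@continuousB _ _ _ (fun v : 'rV[R]_N => (1 + alpha) *
    ln (\det (weighted_scatter (fun i => v 0 i))))
    (fun v : 'rV[R]_N => K%:R / N%:R * \sum_i ln (v 0 i))).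
  apply: (@continuousM _ _ (fun=> 1 + alpha)
    (fun v : 'rV[R]_N => ln (\det (weighted_scatter (fun i => v 0 i))))).
    exact: cst_continuous.
  apply: cln; first by apply: posdef_det_gt0; exact: posdef_weighted_scatter.
  apply: continuous_det => p q.
  rewrite (_ : (fun _ => _) = fun y : 'rV[R]_N =>
      (alpha *: T) p q + \sum_i y 0 i * (x i *m (x i)^T) p q); last first.
    apply/funext => y; rewrite mxE summxE; congr (_ + _).
    by apply: eq_bigr => i _; rewrite mxE.
  apply: (@continuousD _ _ _ (fun=> (alpha *: T) p q)
    (fun y : 'rV[R]_N => \sum_i y 0 i * (x i *m (x i)^T) p q)).
    exact: cst_continuous.
  apply: continuous_for_sum => i _; apply: continuousM; first exact: coord_continuous.
  exact: cst_continuous.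
apply: (@continuousM _ _ (fun=> K%:R / N%:R) (fun v : 'rV[R]_N => \sum_i ln (v 0 i))).
  exact: cst_continuous.
by apply: continuous_for_sum => i _; apply: cln => //; exact: coord_continuous.
Qed.

(** A minimizer over the compact box is global, since every positive weight vector is matched or
    beaten inside the box. *)
Lemma dual_minimizer : exists w, (forall i, 0 < w i) /\
  forall w', (forall i, 0 < w' i) -> dual_loss w <= dual_loss w'.
Proof.
have [b [B [bp bB hbox]]] : exists b B, [/\ 0 < b, b <= B &
    forall w, (forall i, 0 < w i) ->
    exists w', (forall i, b <= w' i <= B) /\ dual_loss w' <= dual_loss w].
  move: (alpha_ge0); rewrite le_eqVlt => /orP[/eqP al|al].
    exact: dual_sublevel_unregularized.
  exact: dual_sublevel_regularized.
pose A := [set v : 'rV[R]_N | forall i, v ord0 i \in `[b, B]].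
have Apos v : A v -> forall i, 0 < v 0 i.
  by move=> Av i; have := Av i; rewrite in_itv /= => /andP[+ _]; exact: lt_le_trans.
have Acomp : compact A.
  by apply: (@rV_compact _ _ (fun=> `[b, B]%classic)) => _; exact: segment_compact.
have A0 : A !=set0.
  by exists (const_mx b) => i; rewrite mxE in_itv /= lexx.
have cA : {within A, continuous (fun v : 'rV[R]_N => dual_loss (fun i => v 0 i))}.
  apply: continuous_in_subspaceT => v /set_mem Av.
  by apply: dual_loss_continuous; exact: Apos.
have [v /set_mem Av vmin] := EVT_min_rV A0 Acomp cA.
exists (fun i => v 0 i); split; first exact: Apos.
move=> w w0; have [w' [w'b]] := hbox w w0; apply: le_trans.
have Aw' : A (\row_i w' i) by move=> i; rewrite /= mxE in_itv /=; exact: w'b.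
have := vmin _ (mem_set Aw'); move/le_trans; apply.
by rewrite (_ : (fun i => (\row_i w' i) 0 i) = w') //; apply/funext => i; rewrite mxE.
Qed.

(** Changing the single weight [w i] by [s] is a rank-one update, so the loss changes by exactly the
    expression in [log_critical], with [e = (w i)^-1] and [r = w i]. *)
Lemma dual_critical w : (forall i, 0 < w i) ->
  (forall w', (forall i, 0 < w' i) -> dual_loss w <= dual_loss w') ->
  forall i, w i = 1 / (1 + alpha) * (K%:R / N%:R)
                  * (quadform (invmx (weighted_scatter w)) (x i))^-1.
Proof.
move=> w0 wmin i; have hM := posdef_weighted_scatter w0.
set M := weighted_scatter w in hM *; set q := quadform _ _.
have q0 : 0 < q by apply: (posdef_inv hM).2.
have e0 : 0 < (w i)^-1 by rewrite invr_gt0.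
have dM := posdef_det_gt0 hM.
suff e : (1 + alpha) * q = K%:R / N%:R * (w i)^-1.
  have -> : K%:R / N%:R = (1 + alpha) * q * w i by rewrite e mulfVK // gt_eqF.
  by field; rewrite !gt_eqF.
apply: (log_critical b0 c0 (ltW q0) e0 (w0 i)) => s sw s1 s2.
pose w' k := if k == i then w i + s else w k.
have wi : 0 < w i + s by move: sw; rewrite ltr_norml => /andP[]; lra.
have w'0 k : 0 < w' k by rewrite /w'; case: ifP.
have := wmin w' w'0; rewrite -subr_ge0.
have M' : weighted_scatter w' = M + s *: (x i *m (x i)^T).
  rewrite /M /weighted_scatter -addrA; congr (_ + _).
  rewrite (bigD1 i) //= [in RHS](bigD1 i) //= /w' eqxx scalerDl.
  rewrite (eq_bigr (fun k => w k *: (x k *m (x k)^T))) => [|k /negPf -> //].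
  by rewrite addrAC.
have lw' : \sum_k ln (w' k) = \sum_k ln (w k) + ln (1 + s * (w i)^-1).
  rewrite (bigD1 i) //= [in RHS](bigD1 i) //= /w' eqxx.
  have -> : w i + s = w i * (1 + s / w i) by field; rewrite gt_eqF.
  rewrite lnM ?posrE // (eq_bigr (fun k => ln (w k))) => [|k /negPf -> //].
  by rewrite addrAC.
rewrite /dual_loss M' lw' det_add_outer ?posdef_unitmx // lnM ?posrE //.
by rewrite -/M -/q; lra.
Qed.

Lemma solution_exists : exists Sigma, wiesel_solution alpha x T Sigma.
Proof.
have [w [w0 wmin]] := dual_minimizer.
have wE := dual_critical w0 wmin; have hM := posdef_weighted_scatter w0.
exists (weighted_scatter w); split=> //; set M := weighted_scatter w in hM wE *.
have uM := posdef_unitmx hM.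
rewrite /tyler_map addrC {1}/M /weighted_scatter; congr (_ + _); last first.
  by rewrite scaler_sumr; apply: eq_bigr => i _; rewrite scalerA -wE.
move: (alpha_ge0); rewrite le_eqVlt => /orP[/eqP <-|al].
  by rewrite mul0r !scale0r.
have tr_outer i : \tr (invmx M *m (x i *m (x i)^T)) = quadform (invmx M) (x i).
  by rewrite quadform_tr.
(* Criticality gives the sample term; the coefficient of [T] needs the trace of [invmx M *m T],
   obtained by splitting this trace along the definition of [M]. *)
have : \tr (invmx M *m M) = K%:R by rewrite mulVmx // mxtrace1.
rewrite {2}/M /weighted_scatter mulmxDr mulmx_sumr !linearD linear_sum /=.
rewrite -scalemxAr mxtraceZ (eq_bigr (fun=> 1 / (1 + alpha) * (K%:R / N%:R))); last first.
  move=> i _; rewrite -scalemxAr mxtraceZ tr_outer {1}wE mulfVK // gt_eqF //.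
  by apply: (posdef_inv hM).2.
rewrite sumr_const card_ord -[_ *+ N]mulr_natr => trE.
have t : \tr (invmx M *m T) = K%:R / (1 + alpha).
  apply: (mulfI (lt0r_neq0 al)).
  have -> : alpha * \tr (invmx M *m T)
    = K%:R - 1 / (1 + alpha) * (K%:R / N%:R) * N%:R by exact: (canRL (addrK _) trE).
  by field; rewrite !gt_eqF.
by rewrite t scalerA; congr (_ *: _); field; rewrite !gt_eqF.
Qed.

End Existence.

(** * Scaling of solutions and conclusion *)

Lemma wiesel_solution_scale (R : realType) K N (alpha : R) (x : 'I_N -> 'cV[R]_K)
    T Sigma c : 0 < c ->
  wiesel_solution alpha x T Sigma -> wiesel_solution alpha x T (c *: Sigma).
Proof.
move=> c0 [hSig eSig]; split; first exact: posdef_scale.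
have cu : c \is a GRing.unit by rewrite unitfE gt_eqF.
have iE : invmx (c *: Sigma) = c^-1 *: invmx Sigma.
  by rewrite invmxZ // unitmxZ // posdef_unitmx.
rewrite {1}eSig /tyler_map iE scalerDr; congr (_ + _).
  rewrite scalerA mulrC -[LHS]scalerA; congr (_ *: _); rewrite scaler_sumr.
  apply: eq_bigr => i _; rewrite scalerA; congr (_ *: _).
  by rewrite quadformZl invfM invrK.
rewrite scalerA mulrC -[LHS]scalerA; congr (_ *: _); rewrite scalerA; congr (_ *: _).
by rewrite -scalemxAl mxtraceZ invfM invrK mulrCA.
Qed.

Theorem theorem8 (R : realType) (K N : nat) (x : 'I_N -> 'cV[R]_K)
    (T : 'M[R]_K) (alpha0 : R)
    (hK : (0 < K)%N) (hN : (0 < N)%N)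
    (hT : posdefmx T) (halpha0 : 0 <= alpha0)
    (hx : forall i : 'I_N, x i != 0)
    (hS : forall S : {vspace 'cV[R]_K}, proper_subspace S ->
      proportion x S < (1 + alpha0) * (\dim S)%:R / K%:R) :
  [/\ exists Sigma : 'M[R]_K, wiesel_solution alpha0 x T Sigma,
      forall Sigma1 : 'M[R]_K, wiesel_solution alpha0 x T Sigma1 ->
        forall Sigma2 : 'M[R]_K, wiesel_solution alpha0 x T Sigma2 <->
          exists2 c : R, 0 < c & Sigma2 = c *: Sigma1
    & forall Sigma : 'M[R]_K, wiesel_solution alpha0 x T Sigma <->
        posdef_global_min (wiesel_loss alpha0 x T) Sigma].
Proof.
have min Sigma Sigma' := @solution_minimal R K N hK hN alpha0 x T Sigma Sigma' hT
  halpha0 hx hS.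
have ex := solution_exists hK hN hx hT halpha0 hS.
split=> // [Sigma1 sol1 Sigma2|Sigma]; split.
(* Each solution minimizes the loss, so the two losses agree and the equality case applies. *)
- move=> sol2; have [le12 eq12] := min _ _ sol1 sol2.1.
  have [le21 _] := min _ _ sol2 sol1.1.
  by apply: eq12; apply/eqP; rewrite eq_le le12.
- by move=> [c c0 ->]; exact: wiesel_solution_scale.
- by move=> sol; split=> [|Sigma' hSig']; [exact: sol.1|case: (min _ _ sol hSig')].
(* A global minimum has the loss of an existing solution, hence is a multiple of it. *)
- move=> [hSig hmin]; have [Sigma1 sol1] := ex.
  have [le1 eq1] := min _ _ sol1 hSig.
  have [|c c0 ->] := eq1; last exact: wiesel_solution_scale.
  by apply/eqP; rewrite eq_le le1 hmin //; exact: sol1.1.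
Qed.
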